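(* Let $(X,\mu,T)$ be a mildly mixing measure preserving system and let $p_1,\dots,p_k\in\mathbb{Z}[x]$ be polynomials. If for every $i\neq j$ the polynomial $p_i-p_j$ is not constant, then for every idempotent ultrafilter $p\in\beta\mathbb{N}$ and every $f_1,\dots,f_k\in L^\infty(X)$ we have $$p\text{-}\lim_n\ \prod_{i=1}^kT^{p_i(n)}f_i=\prod_{i=1}^k\int_Xf_i\,d\mu\qquad\text{in the weak topology of }L^2(X).$$ In particular, for every $\epsilon>0$ and $f_0\in L^2(X)$, the set $$\left\{n\in\mathbb{N}:\left|\int_Xf_0\cdot\prod_{i=1}^kT^{p_i(n)}f_i\,d\mu-\prod_{i=0}^k\int_Xf_i\,d\mu\right|<\epsilon\right\}$$ is IP$^*$.
   Context: $\beta\mathbb{N}$ is the set of ultrafilters on $\mathbb{N}=\{1,2,\dots\}$, with the semigroup operation extending addition: $A\in p+q$ iff $\{n:\{m:n+m\in A\}\in q\}\in p$. An ultrafilter $p$ is idempotent if $p+p=p$. For a map $u$ from $\mathbb{N}$ into a compact Hausdorff space, $p\text{-}\lim_n u(n)$ is the unique point $x$ such that $\{n:u(n)\in U\}\in p$ for every neighborhood $U$ of $x$ (bounded sets of $L^2(X)$ being taken with the weak topology). Here $(X,\mu,T)$ is an invertible measure preserving system on a probability space and $T^nf=f\circ T^n$. The system is mildly mixing if for every $f\in L^2(X)$ and every idempotent $p\in\beta\mathbb{N}$ we have $p\text{-}\lim_nT^nf=\int_Xf\,d\mu$ in the weak topology. Given an increasing sequence $(n_k)_{k\in\mathbb{N}}$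 in $\mathbb{N}$, the IP-set generated by it is $\{\sum_{k\in\alpha}n_k:\alpha\subset\mathbb{N}\text{ finite, non-empty}\}$; a set $A\subset\mathbb{N}$ is IP$^*$ if it has non-empty intersection with every IP-set.
   Formalization: The formal theorem also assumes that each p_i is non-constant (the pairwise condition with p_0 = 0 included); without this the claim is false, e.g. k = 1, p_1 = 0 on a Bernoulli shift, where it would say f_1 equals its integral. *)

(* Defs.v *)
From HB Require Import structures.
From mathcomp Require Import all_boot all_order all_algebra finmap complex.
From mathcomp Require Import all_classical all_reals all_analysis.

Set Implicit Arguments.
Unset Strict Implicit.
Unset Printing Implicit Defensive.
Import Order.TTheory GRing.Theory Num.Theory.
Import numFieldNormedType.Exports.
Local Open Scope classical_set_scope.
Local Open Scope ring_scope.

(* The positive integers. They are a type of their own, so that the principal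
   ultrafilter at 0 (which is idempotent on nat) is not an ultrafilter here. *)
Definition posnat : Type := {n : nat | (0 < n)%N}.

Lemma addposn_subproof (m n : posnat) : (0 < val m + val n)%N.
Proof. by rewrite addn_gt0 (valP m). Qed.

Definition addposn (m n : posnat) : posnat := Sub _ (addposn_subproof m n).

Definition uf_add (p q : set_system posnat) : set_system posnat :=
  [set A : set posnat | p [set n : posnat | q [set m : posnat | A (addposn n m)]]].

Definition idempotent_ultrafilter (p : set_system posnat) : Prop :=
  UltraFilter p /\ uf_add p p = p.

Definition IP_set (s : nat -> posnat) : set posnat :=
  [set m : posnat | exists a : {fset nat},
     a != fset0 /\ val m = (\sum_(k <- enum_fset a) val (s k))%N].

Definition IP_star (A : set posnat) : Prop :=
  forall s : nat -> posnat,
    (forall i j : nat, (i < j)%N -> (val (s i) < val (s j))%N) ->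
    A `&` IP_set s !=set0.

Section ComplexLp.
Context (d : measure_display) (X : measurableType d) (R : realType).
Variable mu : probability X R.

Definition cintegral (f : X -> R[i]) : R[i] :=
  Complex (\int[mu]_x complex.Re (f x)) (\int[mu]_x complex.Im (f x)).

Definition cLfun (r : \bar R) (f : X -> R[i]) : Prop :=
  [/\ measurable_fun setT (fun x => complex.Re (f x)),
      measurable_fun setT (fun x => complex.Im (f x))
    & (fun x => ComplexField.Normc.normc (f x)) \in Lfun mu r].

Definition cinner (f g : X -> R[i]) : R[i] :=
  cintegral (fun x => f x * conjc (g x)).

Definition cL2 : Type := {g : X -> R[i] | cLfun 2%:E g}.

(* The topology induced by the functionals <., g> for g in L^2. It is put on all
   functions X -> R[i], so that no membership proof has to be carried along;
   on the functions in L^2 it is the weak topology, with a.e. equal functions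
   topologically indistinguishable. *)
Definition weak_eval (f : X -> R[i]) : prod_topology (fun _ : cL2 => R[i]^o) :=
  fun g => cinner f (sval g).

Definition weakL2 : topologicalType := initial_topology weak_eval.

Definition weak_plim (p : set_system posnat) (u : posnat -> X -> R[i])
    (f : X -> R[i]) : Prop :=
  (u : posnat -> weakL2) @ p --> (f : weakL2).

Record invertible_mps := InvertibleMps {
  mps_map :> X -> X;
  mps_inv : X -> X;
  mps_mapK : cancel mps_map mps_inv;
  mps_invK : cancel mps_inv mps_map;
  measurable_mps_map : measurable_fun setT mps_map;
  measurable_mps_inv : measurable_fun setT mps_inv;
  mps_preserving : forall A : set X, measurable A -> mu (mps_map @^-1` A) = mu A
}.

Definition mps_pow (T : invertible_mps) (n : int) : X -> X :=
  match n with
  | Posz k => iter k T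
  | Negz k => iter k.+1 (mps_inv T)
  end.

Definition koopman (T : invertible_mps) (n : int) (f : X -> R[i]) : X -> R[i] :=
  fun x => f (mps_pow T n x).

Definition mildly_mixing (T : invertible_mps) : Prop :=
  forall (f : X -> R[i]) (p : set_system posnat),
    cLfun 2%:E f -> idempotent_ultrafilter p ->
    weak_plim p (fun n => koopman T (Posz (val n)) f) (fun _ => cintegral f).

End ComplexLp.

(* Main.v *)
Require Import Defs.
From HB Require Import structures.
From mathcomp Require Import all_boot all_order all_algebra finmap complex.
From mathcomp Require Import all_classical all_reals all_analysis.
From mathcomp Require Import measurable_realfun ess_sup_inf ring lra.

Set Implicit Arguments.
Unset Strict Implicit.
Unset Printing Implicit Defensive.
Import Order.TTheory GRing.Theory Num.Theory.
Import numFieldNormedType.Exports.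
Local Open Scope classical_set_scope.
Local Open Scope ring_scope.

(** Along an idempotent ultrafilter [p] a limit over [n] is the iterated limit
    over [h] and [n] of the translate at [h + n]. This gives a van der Corput
    lemma ([van_der_corput]) whose hypotheses are iterated limits along [p]
    itself: if the integrals of a bounded sequence [u n] converge to [c] and the
    correlations of [u (h + n)] and [u n] converge to [c ^+ 2], first in [n] and
    then in [h], then [u n] converges weakly to the constant [c]. Its proof is
    Bessel's inequality for long sequences of almost orthogonal vectors, and
    these come from idempotence ([idempotent_tower]).

    For bounded real functions the theorem follows by polynomial exhaustion
    ([mildly_mixing_family]). The correlation of [u (h + n)] and [u n], where
    [u n] is the product of the functions [f_i] read at time [p_i n], is again
    the integral of a product along polynomials, namely the [p_i] and their
    translates by [h]. An affine [p_i] differs from its translate by a constant,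
    so the two are merged into one polynomial with the function
    [f_i * T ^ (a h) f_i]; for all other polynomials the family stays distinct
    modulo constants for [p]-almost every [h]. As the measure is invariant, a
    member of minimal degree may be subtracted from all the others and frozen,
    and the resulting family precedes the original one in the order that
    compares the numbers of leading coefficients in each degree, high degrees
    first ([weight_sub]). By induction the limit over [n] is the product of the
    integrals. The limit over [h] then only concerns the merged affine members,
    where mild mixing for powers of [T] applies ([mildly_mixing_pow]). Freezing a
    member of the family itself gives the limit [c] of the integrals of [u n].

    The passage to functions in [L ^ oo] and to square integrable test functions
    is approximation and multilinearity ([cvg_real_integrable],
    [cvg_complex_bounded], [cvg_complex]). For the IP* statement one needs, in
    each IP set, an idempotent ultrafilter that contains it
    ([IP_set_idempotent]); it comes from Ellis' lemma ([exists_idempotent]). *)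

(** * Idempotent ultrafilters *)

Lemma addposnA : associative addposn.
Proof. by move=> a b c; apply: val_inj; rewrite /= addnA. Qed.

Section Idempotent.
Variable p : set_system posnat.
Hypothesis hp : idempotent_ultrafilter p.

#[local] Instance idempotent_ultra : UltraFilter p := hp.1.

Let near_ex (A : set posnat) : p A -> A !=set0.
Proof. exact: filter_ex. Qed.

Let nearI (A B : set posnat) : p A -> p B -> p (A `&` B).
Proof. exact: filterI. Qed.

Lemma idempotent_near2 (A : set posnat) :
  p A -> p [set h | p [set n | A (addposn h n)]].
Proof. by move=> pA; move: (pA); rewrite -{1}hp.2. Qed.

(** If [p] were concentrated at [h0], idempotence would force [h0 + h0 = h0],
    and [h0] is positive. *)
Lemma idempotent_nonprincipal (h0 : posnat) : p [set h | h != h0].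
Proof.
have [ph|] := in_ultra_setVsetC [set h0] hp.1; last first.
  by apply: filterS => h /= /eqP.
have /near_ex[h] := nearI ph (idempotent_near2 ph).
case=> /= -> /(nearI ph) /near_ex[n] [/= ->] /(congr1 val) /= /eqP.
by rewrite -[X in _ == X]addn0 eqn_add2l => h00; move: (valP h0); rewrite lt0n h00.
Qed.

Lemma ultra_near_or (A B : set posnat) : p (A `|` B) -> p A \/ p B.
Proof.
move=> pAB; have [|pnA] := in_ultra_setVsetC A hp.1; first by left.
by right; apply: filterS (nearI pAB pnA) => x [[//|//]].
Qed.

(** The combinatorial core of the van der Corput argument. Each new element is
    of the form [n0 + m] with [m] the previous head, so that all the pairs of
    the sequence have the form [(h + m, m)] for an [h] that idempotence makes
    as typical as [n0]; replacing [S] by its intersection with the translate by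
    [n0] is what makes the induction go through. *)
Lemma idempotent_tower (N : nat) (B : set posnat) (S : posnat -> posnat -> bool) :
  p B -> p [set h | p [set m | S (addposn h m) m]] ->
  exists ms : seq posnat,
    [/\ size ms = N, forall m, m \in ms -> B m & pairwise S ms].
Proof.
elim: N B S => [|N IHN] B S pB pS; first by exists [::].
have pS2 := idempotent_near2 pS.
have /near_ex[n0 [[pn0B pn0S] pn0S2]] :=
  nearI (nearI (idempotent_near2 pB) pS) pS2.
have [ms [szms Bms Sms]] := IHN
  (B `&` [set m | B (addposn n0 m)] `&` [set m | S (addposn n0 m) m])
  (fun a b => S a b && S (addposn n0 a) b)
  (nearI (nearI pB pn0B) pn0S)
  ltac:(apply: filterS (nearI pS pn0S2) => h [/= h1 h2];
        apply: filterS (nearI h1 h2) => m [/= -> +] /=;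
        by rewrite addposnA).
case: ms szms Bms Sms => [|m ms] /= szms Bms Sms.
  have /near_ex[m Bm] := pB.
  by exists [:: m]; split; rewrite -?szms//= => n; rewrite inE => /eqP->.
have [[Bm Bn0m] Sn0m] := Bms _ (mem_head _ _).
exists [:: addposn n0 m, m & ms]; split; first by rewrite /= szms.
  move=> k; rewrite !inE => /or3P[/eqP->//|/eqP->//|kms].
  by have /Bms[[]] : k \in m :: ms by rewrite inE kms orbT.
move: Sms => /andP[Sm Sms] /=; apply/and3P; split.
- apply/andP; split=> //; apply: sub_all Sm => b /andP[_ ?]//.
- by apply: sub_all Sm => b /andP[].
- by apply: sub_pairwise Sms => a b /andP[].
Qed.

End Idempotent.

Lemma mulposn_subproof (a n : posnat) : (0 < val a * val n)%N.
Proof. by rewrite muln_gt0 (valP a) (valP n). Qed.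

Definition mulposn (a n : posnat) : posnat := Sub _ (mulposn_subproof a n).

Lemma mulposnDr a : {morph mulposn a : m n / addposn m n}.
Proof. by move=> m n; apply: val_inj; rewrite /= mulnDr. Qed.

Lemma ultra_fmap (T U : Type) (f : T -> U) (F : set_system T) :
  UltraFilter F -> UltraFilter (f @ F).
Proof.
move=> FU; split; first exact: fmap_proper_filter.
move=> G GF FG; apply/seteqP; split=> // A GA.
have [//|FnA] := in_ultra_setVsetC (f @^-1` A) FU.
have GnA : G (~` A) by exact: FG.
by have /filter_ex [? []] : G (A `&` (~` A)) by exact: filterI.
Qed.

Lemma idempotent_mul (a : posnat) (p : set_system posnat) :
  idempotent_ultrafilter p -> idempotent_ultrafilter (mulposn a @ p).
Proof.
move=> hp; split; first exact/ultra_fmap/hp.1.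
apply/funext => A; change (p [set n | p [set m |
  A (addposn (mulposn a n) (mulposn a m))]] = p [set n | A (mulposn a n)]).
rewrite -[in RHS]hp.2; congr (p _); apply/funext => n.
by congr (p _); apply/funext => m /=; rewrite mulposnDr.
Qed.

(** A filter [F] stands for the closed set of the ultrafilters that extend it;
    the inclusion of [F] in [uf_add F F] makes this closed set a subsemigroup
    of the ultrafilters. *)
Definition subsemigroup_filter (F0 F : set_system posnat) : Prop :=
  [/\ ProperFilter F, F0 `<=` F & F `<=` uf_add F F].

Lemma uf_add_proper (F G : set_system posnat) :
  ProperFilter F -> ProperFilter G -> ProperFilter (uf_add F G).
Proof.
move=> FF FG; apply: Build_ProperFilter_ex.
  move=> A /= FA; have /filter_ex[n] : F _ := FA.
  by move=> /= GA; have /filter_ex[m Am] : G _ := GA; exists (addposn n m).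
split.
- by apply: (@filterE _ F) => n; apply: (@filterE _ G).
- move=> A B FA FB; apply: (@filterS _ F) (@filterI _ F _ _ _ FA FB) => n [].
  exact: (@filterI _ G).
- move=> A B AB; apply: (@filterS _ F) => n.
  by apply: (@filterS _ G) => m; exact: AB.
Qed.

Lemma maximal_subsemigroup_filter (F0 : set_system posnat) :
  subsemigroup_filter F0 F0 ->
  exists F, subsemigroup_filter F0 F /\
    forall G, subsemigroup_filter F0 G -> F `<=` G -> G = F.
Proof.
move=> s0.
(* adding [F0] makes the empty chain harmless *)
pose P := [set F : set_system posnat | subsemigroup_filter F0 (F0 `|` F)].
have [C CP totC|F [PF Fmax]] := @Zorn_bigcup _ P; last first.
  exists (F0 `|` F); split=> // G sG FG; apply/seteqP; split=> // A GA.
  have [_ F0G _] := sG.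
  right; apply: contrapT => nFA; apply: (Fmax G); last first.
    by rewrite /P /= ((setUidPr _ _).2 F0G).
  by split; [move=> B FB; apply: FG; right | move=> /(_ A GA)].
have [[F1 CF1]|C0] := pselect (C !=set0); last first.
  rewrite /P /= bigcup0 ?setU0// => F CF.
  by exfalso; apply: C0; exists F.
have WC A : (F0 `|` \bigcup_(F in C) F) A -> exists2 F, C F & (F0 `|` F) A.
  by case=> [F0A|[F CF FA]]; [exists F1 => //; left | exists F => //; right].
have CW F : C F -> F0 `|` F `<=` F0 `|` \bigcup_(F in C) F.
  by move=> CF A [|FA]; [left | right; exists F].
split; last 2 first.
- by move=> A F0A; left.
- move=> A /WC[F CF FA]; have [FF _ /(_ _ FA)] := CP _ CF.
  rewrite /uf_add /= => FA'; apply: (CW _ CF); apply: filterS FA' => n.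
  exact: (CW _ CF).
apply: Build_ProperFilter_ex.
  by move=> A /WC[F CF FA]; have [FF _ _] := CP _ CF; exact: filter_ex FA.
split.
- by apply: (CW _ CF1); have [FF _ _] := CP _ CF1; exact: filterT.
- move=> A B /WC[F CF FA] /WC[G CG GB].
  have [FF _ _] := CP _ CF; have [GF _ _] := CP _ CG.
  have [FG|GF'] := totC _ _ CF CG.
    by apply: (CW _ CG); apply: filterI GB; case: FA => [|/FG]; [left|right].
  by apply: (CW _ CF); apply: filterI => //; case: GB => [|/GF']; [left|right].
- move=> A B AB /WC[F CF FA]; have [FF _ _] := CP _ CF.
  by apply: (CW _ CF); exact: filterS FA.
Qed.

(** Ellis' lemma, with closed subsemigroups of ultrafilters replaced by filters:
    for [F] maximal and an ultrafilter [V] above it, [F + V] is again a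
    subsemigroup filter above [F], hence [F + V = F]; this equality makes the
    closed semigroup of the [U] above [F] with [U + V = V] nonempty, and
    maximality applied to its filter yields [V = V + V]. *)
Lemma exists_idempotent (F0 : set_system posnat) :
  subsemigroup_filter F0 F0 ->
  exists p, idempotent_ultrafilter p /\ F0 `<=` p.
Proof.
move=> /maximal_subsemigroup_filter[F [[FF F0F FFF] Fmax]].
have [V [VU FV]] := ultraFilterLemma FF.
exists V; split; last exact: subset_trans FV.
have FaddV : uf_add F V = F.
  have FVF : F `<=` uf_add F V.
    by move=> A /FFF; apply: (@filterS _ F) => n; exact: FV.
  apply: Fmax => //; split; [exact: uf_add_proper|exact: subset_trans FVF|].
  move=> A FVA; have /FFF := FVA; apply: (@filterS _ F) => m /FFF FA.
  apply: FV; apply: (@filterS _ F) FA => n; apply: (@filterS _ F) => a.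
  apply: (@filterS _ V) => b /=; by rewrite !addposnA.
pose tr A := [set n | V [set m | A (addposn n m)]].
pose G : set_system posnat := filter_from [set BA | F BA.1 /\ V BA.2]
  (fun BA : set posnat * set posnat => BA.1 `&` tr BA.2).
have FG : F `<=` G.
  move=> B FB; exists (B, setT) => [|n []//]; split=> //=; exact: filterT.
have trG A : V A -> G (tr A).
  move=> VA; exists (setT, A) => [|n []//]; split=> //=; exact: filterT.
have GF : ProperFilter G.
  apply: filter_from_proper => [|[B A] /= [FB VA]]; last first.
    apply: contrapT => /set0P/negP; rewrite negbK => /eqP BA0.
    have : uf_add F V (~` A).
      apply: (@filterS _ F) FB => n Bn; have [] // := in_ultra_setVsetC
        [set m | (~` A) (addposn n m)] VU.
      rewrite preimage_setC setCK => VAn.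
      by have : (B `&` tr A) n by []; rewrite BA0.
    rewrite FaddV => /FV VnA.
    by have /filter_ex[x []] : V (A `&` ~` A) by exact: filterI.
  apply: filter_from_filter; first by exists (setT, setT); split; exact: filterT.
  move=> [B A] [B' A'] [/= FB VA] [/= FB' VA'].
  exists (B `&` B', A `&` A'); first by split; exact: filterI.
  by move=> n /= [[Bn B'n] VAn]; split; split=> //; apply: filterS VAn => m [].
have GFe : G = F.
  apply: Fmax => //; split=> //; first exact: subset_trans FG.
  move=> C [[B A] /= [FB VA] BAC].
  have B2 : G [set n | G [set m | B (addposn n m)]].
    by apply/FG; apply: (@filterS _ F) (FFF _ FB) => n; exact: FG.
  apply: (@filterS _ G) (filterI B2 (trG _ VA)) => n [Gn /trG An].
  apply: (@filterS _ G) (filterI Gn An) => m [Bnm Anm].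
  apply: BAC; split=> //=; move: Anm; rewrite /tr /=.
  by apply: (@filterS _ V) => b /=; rewrite addposnA.
have VVV : V `<=` uf_add V V by move=> A /trG; rewrite GFe => /FV.
by split=> //; apply: max_filter => //; exact: uf_add_proper.
Qed.

Section IPset.
Variable s : nat -> posnat.

(** A sum of terms of index less than [n] may be added to any element of the
    tail at [n] without repeating an index, and this makes the filter of the
    tails a subsemigroup filter. *)

Definition IP_tail (n : nat) : set posnat :=
  [set m | exists a : {fset nat}, [/\ a != fset0,
     forall k, k \in a -> (n <= k)%N &
     val m = (\sum_(k <- enum_fset a) val (s k))%N]].

Lemma IP_tailS m n : (m <= n)%N -> IP_tail n `<=` IP_tail m.
Proof.
by move=> mn x [a [a0 an xa]]; exists a; split=> // k /an; exact: leq_trans.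
Qed.

Lemma IP_tail_filter : subsemigroup_filter (filter_from setT IP_tail)
  (filter_from setT IP_tail).
Proof.
split=> //.
- apply: filter_from_proper => [|n _].
    apply: filter_from_filter; first by exists 0%N.
    move=> i j _ _; exists (maxn i j) => // x xij.
    by split; apply: IP_tailS xij; rewrite ?leq_maxl ?leq_maxr.
  exists (s n), [fset n]%fset; split.
  + by apply/fset0Pn; exists n; rewrite in_fset1.
  + by move=> k; rewrite in_fset1 => /eqP->.
  + by rewrite big_seq_fset1.
- move=> A [n _ nA]; exists n => // x [a [a0 an xa]].
  pose K := (\max_(k <- enum_fset a) k).+1.
  have aK k : k \in a -> (k < K)%N.
    by move=> ka; rewrite ltnS; exact: leq_bigmax_seq.
  have [k0 k0a] := fset0Pn _ a0.
  exists K => // y [b [b0 bK yb]].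
  have pab : perm_eq (enum_fset (a `|` b)%fset) (enum_fset a ++ enum_fset b).
    apply: uniq_perm; rewrite ?cat_uniq ?fset_uniq ?andbT//=.
      by apply/hasPn => k /bK Kk; apply/negP => /aK; rewrite ltnNge Kk.
    by move=> k; rewrite mem_cat; exact: in_fsetU.
  apply: nA; exists (a `|` b)%fset; split.
  + by apply/fset0Pn; exists k0; rewrite in_fsetU k0a.
  + move=> k; rewrite in_fsetU => /orP[/an//|/bK]; apply: leq_trans.
    by rewrite (leq_trans (an _ k0a))// ltnW// aK.
  + by rewrite (perm_big _ pab) big_cat/= -xa -yb.
Qed.

Lemma IP_set_idempotent : exists p, idempotent_ultrafilter p /\ p (IP_set s).
Proof.
have [p [hp Fp]] := exists_idempotent IP_tail_filter.
by exists p; split=> //; apply: Fp; exists 0%N => // x [a [a0 _ xa]]; exists a.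
Qed.

End IPset.

(** * Families of polynomials *)

(** Weight vectors of length [D] are compared at the largest index where they
    differ. This is well-founded by induction on [D]: for a given value of the
    top entry, the remaining entries form a shorter vector. *)
Lemma weight_ind (D : nat) (Q : (nat -> nat) -> Prop) :
  (forall w, (forall w', (exists2 d, (d < D)%N &
       (w' d < w d)%N /\ forall e, (d < e < D)%N -> (w' e <= w e)%N) -> Q w') ->
     Q w) ->
  forall w, Q w.
Proof.
elim: D Q => [|D IHD] Q step w; first by apply: step => w' [].
move: {2}(w D) (leqnn (w D)) => m.
elim/ltn_ind: m w => m IHm w wm.
move: (w) wm; apply: (IHD (fun w => (w D <= m)%N -> Q w)) => {}w IHw wm.
apply: step => w' [d]; rewrite ltnS leq_eqVlt => /predU1P[->|dD] [ww' lew].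
  exact: IHm (leq_trans ww' wm) _ (leqnn _).
apply: IHw; last by rewrite (leq_trans _ wm)// lew// dD ltnSn.
by exists d => //; split=> // e /andP[de eD]; rewrite lew// de ltnW.
Qed.

(** Distinct modulo constants. *)
Definition distinct (P Q : {poly int}) : bool := (1 < size (P - Q)%R)%N.

Lemma distinctC : symmetric distinct.
Proof. by move=> P Q; rewrite /distinct -opprB size_polyN. Qed.

Lemma distinctxx P : distinct P P = false.
Proof. by rewrite /distinct subrr size_poly0. Qed.

Lemma distinctB P Q S : distinct (P - S) (Q - S) = distinct P Q.
Proof. by rewrite /distinct opprB addrA subrK. Qed.

Lemma pairwise_distinctP ps :
  pairwise distinct ps <->
  uniq ps /\ {in ps &, forall P Q, P != Q -> distinct P Q}.
Proof.
elim: ps => [|P ps IH] //=; split.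
  case/andP => /allP Pps /IH[ups dps]; split.
    by rewrite ups andbT; apply/negP => /Pps; rewrite distinctxx.
  move=> A B; rewrite !inE => /predU1P[->|Aps] /predU1P[->|Bps] //.
  - by rewrite eqxx.
  - by move=> _; exact: Pps.
  - by move=> _; rewrite distinctC; exact: Pps.
  - exact: dps.
case=> /andP[Pps ups] dps; apply/andP; split; last first.
  by apply/IH; split=> // A B Aps Bps; apply: dps; rewrite inE ?Aps ?Bps orbT.
apply/allP => B Bps; apply: dps; rewrite ?inE ?eqxx ?Bps ?orbT//.
by apply: contraNneq Pps => ->.
Qed.

Lemma perm_pairwise_distinct ps qs :
  perm_eq ps qs -> pairwise distinct ps -> pairwise distinct qs.
Proof.
move=> pq /pairwise_distinctP[ups dps]; apply/pairwise_distinctP.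
rewrite -(perm_uniq pq); split=> // P Q; rewrite -!(perm_mem pq); exact: dps.
Qed.

Definition translate (h : posnat) (P : {poly int}) : {poly int} :=
  P \Po ('X + (Posz (val h))%:P).

Lemma horner_translate h P (n : int) :
  (translate h P).[n] = P.[n + Posz (val h)].
Proof. by rewrite horner_comp !hornerE. Qed.

Lemma size_translate h P : size (translate h P) = size P.
Proof. by rewrite size_comp_poly2// size_XaddC. Qed.

Lemma lead_coef_translate h P : lead_coef (translate h P) = lead_coef P.
Proof.
rewrite lead_coef_comp ?size_XaddC//.
by rewrite (monicP (monicXaddC _)) expr1n mulr1.
Qed.

Lemma translateB h P Q : translate h (P - Q) = translate h P - translate h Q.
Proof. exact: raddfB. Qed.

Lemma distinct_translate h P Q :
  distinct (translate h P) (translate h Q) = distinct P Q.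
Proof. by rewrite /distinct -translateB size_translate. Qed.

Lemma poly_nat_roots0 (P : {poly int}) :
  (forall j : nat, root P j%:Z) -> P = 0.
Proof.
move=> rP; apply/eqP; apply: contraT => P0.
have := @max_poly_roots _ P [seq j%:Z | j <- iota 0 (size P)] P0.
rewrite size_map size_iota ltnn => -> //.
  by apply/allP => _ /mapP[j _ ->].
by rewrite map_inj_uniq ?iota_uniq// => i j [].
Qed.

(** If two translates of [P] by distinct [a], [b] both differ from [Q] by a
    constant, then [P] grows by the same amount at each step of length [b - a]
    and is therefore affine. *)
Lemma distinct_translate_inj (P Q : {poly int}) (a b : posnat) :
  (2 < size P)%N -> ~~ distinct (translate a P) Q ->
  ~~ distinct (translate b P) Q -> a = b.
Proof.
move=> sP da db; apply: contraTeq sP => ab; rewrite -leqNgt.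
pose t : int := Posz (val b) - Posz (val a).
have t0 : t != 0.
  by rewrite subr_eq0; apply: contraNneq ab => -[] /val_inj ->.
have [c Pc] : exists c, forall x, P.[x + t] = P.[x] + c.
  have : ~~ distinct (translate b P) (translate a P).
    rewrite /distinct -leqNgt in da; rewrite /distinct -leqNgt in db.
    rewrite /distinct -leqNgt.
    rewrite -[translate b P](subrK Q) -addrA (leq_trans (size_polyD _ _))//.
    by rewrite geq_max db -opprB size_polyN.
  rewrite /distinct -leqNgt => /size1_polyC eC.
  exists (translate b P - translate a P)`_0 => x.
  have := congr1 (horner^~ (x - Posz (val a))) eC.
  rewrite hornerC hornerD hornerN !horner_translate subrK => <-.
  by rewrite [RHS]addrC subrK -addrA [- _ + _]addrC.
have Pj (j : nat) : P.[t * j%:Z] = P.[0] + c * j%:Z.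
  elim: j => [|j IHj]; first by rewrite !mulr0 addr0.
  by rewrite -addn1 PoszD !mulrDr !mulr1 Pc IHj addrA.
have sX : size ('X * t%:P : {poly int}) = 2%N.
  by rewrite size_XmulC.
rewrite -(size_comp_poly2 P sX).
have -> : P \Po ('X * t%:P) = P.[0]%:P + c%:P * 'X.
  apply/eqP; rewrite -subr_eq0; apply/eqP/poly_nat_roots0 => j.
  apply/rootP; rewrite hornerD hornerN horner_comp !hornerE mulrC Pj.
  by rewrite subrr.
rewrite addrC; apply: (leq_trans (size_polyD _ _)).
rewrite geq_max (leq_trans (size_polyC_leq1 _))// andbT.
by rewrite mul_polyC (leq_trans (size_scale_leq _ _))// size_polyX.
Qed.

Lemma idempotent_near_distinct (p : set_system posnat) (P Q : {poly int}) :
  idempotent_ultrafilter p -> (2 < size P)%N ->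
  p [set h | distinct (translate h P) Q].
Proof.
move=> hp sP; have FF : ProperFilter p := @ultra_proper _ _ hp.1.
have [[h0 h0P]|nh] := pselect (exists h0, ~~ distinct (translate h0 P) Q).
  apply: filterS (idempotent_nonprincipal hp h0) => h /=.
  by apply: contraNT => hP; apply/eqP/(distinct_translate_inj sP hP h0P).
apply: filterE => h /=; apply: contrapT => /negP hP; apply: nh.
by exists h.
Qed.

(** The polynomials that occur in [u (n + h) * u n] for a product [u n] along
    the family [ps]: an affine polynomial and its translate differ by a constant
    and are merged. *)
Definition doubled (h : posnat) (ps : seq {poly int}) : seq {poly int} :=
  flatten [seq if size P == 2%N then [:: P] else [:: P; translate h P] |
    P : {poly int} <- ps].

Lemma mem_doubled h (ps : seq {poly int}) Q : Q \in doubled h ps ->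
  exists2 P, P \in ps & size Q = size P /\ lead_coef Q = lead_coef P.
Proof.
move=> /flatten_mapP[P Pps QP]; exists P => //; move: QP.
case: ifP => _; rewrite !inE; first by move=> /eqP->.
by case/orP => /eqP -> //; rewrite size_translate lead_coef_translate.
Qed.

Lemma pairwise_doubled h (ps : seq {poly int}) :
  (forall P Q : {poly int}, P \in ps -> Q \in ps -> size P != 2%N ->
     distinct (translate h P) Q) ->
  pairwise distinct ps -> pairwise distinct (doubled h ps).
Proof.
elim: ps => [//|P ps IH] gen /= /andP[Pps dps].
rewrite /doubled /= pairwise_cat -/(doubled h ps) IH//; last first.
  by move=> A B Aps Bps; apply: gen; rewrite inE ?Aps ?Bps orbT.
rewrite andbT; apply/andP; split; last first.
  case: ifPn => //= sP; rewrite !andbT distinctC gen ?mem_head//.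
apply/allrelP => A B AP /flatten_mapP[Q Qps BQ].
have dPQ : distinct P Q by exact: (allP Pps).
have Qin : Q \in P :: ps by rewrite inE Qps orbT.
move: AP BQ; case: ifPn => [_|sP]; case: ifPn => [_|sQ]; rewrite !inE.
- by move=> /eqP-> /eqP->.
- move=> /eqP-> /orP[]/eqP-> //.
  by rewrite distinctC gen// mem_head.
- by move=> /orP[]/eqP-> /eqP-> //; rewrite gen// mem_head.
- move=> /orP[]/eqP-> /orP[]/eqP->//.
  + by rewrite distinctC gen// mem_head.
  + by rewrite gen// mem_head.
  + by rewrite distinct_translate.
Qed.

Lemma idempotent_near_doubled (p : set_system posnat) (ps : seq {poly int}) :
  idempotent_ultrafilter p -> {in ps, forall P : {poly int}, (1 < size P)%N} ->
  pairwise distinct ps -> p [set h | pairwise distinct (doubled h ps)].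
Proof.
move=> hp sps dps; have FF : ProperFilter p := @ultra_proper _ _ hp.1.
suff : p [set h | forall PQ : {poly int} * {poly int},
    PQ \in [seq (P, Q) | P <- ps, Q <- ps] ->
    size PQ.1 != 2%N -> distinct (translate h PQ.1) PQ.2].
  apply: filterS => h hps; apply: pairwise_doubled => // P Q Pps Qps.
  by apply: (hps (P, Q)); exact: allpairs_f.
have : {in [seq (P, Q) | P <- ps, Q <- ps],
    forall PQ : {poly int} * {poly int}, (1 < size PQ.1)%N}.
  by move=> _ /allpairsP[[P Q] [/= Pps _ ->]]; exact: sps.
elim: [seq _ | _ <- _, _ <- _] => [|[P Q] s IHs] ss.
  by apply: filterE => h.
have ps' : p [set h | size P != 2%N -> distinct (translate h P) Q].
  have [sP|sP] := eqVneq (size P) 2%N; first by apply: filterE => h.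
  have sP2 : (2 < size P)%N.
    by rewrite ltn_neqAle eq_sym sP (ss (P, Q))// mem_head.
  by apply: filterS (idempotent_near_distinct Q hp sP2) => h dh _.
apply: filterS (filterI ps' (IHs _)) => [h [hPQ hs] A|A As].
  by rewrite inE => /predU1P[->//|/hs].
by apply: ss; rewrite inE As orbT.
Qed.

(** The classes counted here are those of polynomial exhaustion: a degree,
    that is [d.-1], together with a leading coefficient. *)
Definition weight (ps : seq {poly int}) (d : nat) : nat :=
  size (undup [seq lead_coef P | P : {poly int} <- ps & size P == d]).

Lemma weight_le (qs : seq {poly int}) (d : nat) (s : seq int) :
  (forall Q : {poly int}, Q \in qs -> size Q = d -> lead_coef Q \in s) ->
  (weight qs d <= size s)%N.
Proof.
move=> qss; apply: uniq_leq_size; first exact: undup_uniq.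
move=> c; rewrite mem_undup => /mapP[Q]; rewrite mem_filter => /andP[/eqP sQ Qqs] ->.
exact: qss.
Qed.

(** Subtracting a member [P] of minimal degree does not affect what happens in
    higher degree, and in the degree of [P] it translates the leading
    coefficients by [- lead_coef P], which eliminates one of them. *)
Lemma weight_sub (D : nat) (ps qs : seq {poly int}) (P : {poly int}) :
  P \in ps -> {in ps, forall Q : {poly int}, (size P <= size Q)%N} ->
  (0 < size P < D)%N ->
  (forall Q : {poly int}, Q \in qs -> exists2 Q', Q' \in ps &
     size (Q + P) = size Q' /\ lead_coef (Q + P) = lead_coef Q') ->
  exists2 d, (d < D)%N & (weight qs d < weight ps d)%N /\
    forall e, (d < e < D)%N -> (weight qs e <= weight ps e)%N.
Proof.
move=> Pps Pmin /andP[P0 PD] qsP; exists (size P) => //.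
have memw Q e : Q \in ps -> size Q = e ->
    lead_coef Q \in undup [seq lead_coef P | P : {poly int} <- ps & size P == e].
  by move=> Qps Qe; rewrite mem_undup map_f// mem_filter Qe eqxx.
split.
  have wP := memw _ _ Pps erefl.
  rewrite [ltnRHS]/weight; set W := undup _ in wP *.
  rewrite -[ltnRHS](prednK _); last by case: (W) wP.
  rewrite ltnS -(size_rem wP) -(size_map (fun c => c - lead_coef P) (rem _ W)).
  apply: weight_le => Q /qsP[Q' Q'ps [sQ lQ]] QP.
  have sQ'P : size Q' = size P.
    apply/eqP; rewrite eqn_leq Pmin// andbT -sQ.
    by rewrite (leq_trans (size_polyD _ _))// geq_max QP leqnn.
  have lcQ : lead_coef Q = lead_coef Q' - lead_coef P.
    rewrite -lQ !lead_coefE sQ sQ'P coefD QP addrK.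
    by [].
  rewrite lcQ (mem_map (@addIr _ (- lead_coef P))) mem_rem_uniq ?undup_uniq//.
  rewrite inE (memw _ _ Q'ps sQ'P) andbT -subr_eq0 -lcQ lead_coef_eq0.
  by rewrite -size_poly_gt0 QP.
move=> e /andP[Pe eD]; apply: weight_le => Q /qsP[Q' Q'ps [sQ lQ]] Qe.
by rewrite -(lead_coefDl (q := P)) ?lQ ?memw// -?sQ ?size_polyDl ?Qe.
Qed.

(** * Bounded measurable functions and their integrals *)

Section Bounded.
Context (d : measure_display) (X : measurableType d) (R : realType).
Variable mu : probability X R.
Implicit Types f g : X -> R.

(** The bound holds everywhere, so that composition with powers of [T] raises no
    question about null sets. *)
Definition bmfun f : Prop :=
  measurable_fun setT f /\ exists M, forall x, `|f x| <= M.

Lemma bmfun_cst (c : R) : bmfun (fun _ => c).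
Proof. by split; [exact: measurable_cst | exists `|c|]. Qed.

Lemma bmfunD f g : bmfun f -> bmfun g -> bmfun (fun x => f x + g x).
Proof.
move=> [mf [M fM]] [mg [N gN]]; split; first exact: measurable_funD.
by exists (M + N) => x; rewrite (le_trans (ler_normD _ _))// lerD.
Qed.

Lemma bmfunM f g : bmfun f -> bmfun g -> bmfun (fun x => f x * g x).
Proof.
move=> [mf [M fM]] [mg [N gN]]; split; first exact: measurable_funM.
by exists (M * N) => x; rewrite normrM ler_pM.
Qed.

Lemma bmfunZ (c : R) f : bmfun f -> bmfun (fun x => c * f x).
Proof. by move=> bf; exact: bmfunM (bmfun_cst c) bf. Qed.

Lemma bmfunN f : bmfun f -> bmfun (fun x => - f x).
Proof.
move=> [mf [M fM]]; split; first exact: measurable_funN.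
by exists M => x; rewrite normrN.
Qed.

Lemma bmfunB f g : bmfun f -> bmfun g -> bmfun (fun x => f x - g x).
Proof. by move=> bf bg; exact: bmfunD bf (bmfunN bg). Qed.

Lemma bmfun_sum (I : Type) (s : seq I) (F : I -> X -> R) :
  (forall i, bmfun (F i)) -> bmfun (fun x => \sum_(i <- s) F i x).
Proof.
move=> bF; elim: s => [|i s IHs].
  by under eq_fun do rewrite big_nil; exact: bmfun_cst.
by under eq_fun do rewrite big_cons; exact: bmfunD.
Qed.

Lemma bmfun_prod (I : eqType) (s : seq I) (F : I -> X -> R) :
  {in s, forall i, bmfun (F i)} -> bmfun (fun x => \prod_(i <- s) F i x).
Proof.
elim: s => [|i s IHs] bF.
  by under eq_fun do rewrite big_nil; exact: bmfun_cst.
under eq_fun do rewrite big_cons.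
apply: bmfunM; first by apply: bF; exact: mem_head.
by apply: IHs => j js; apply: bF; rewrite inE js orbT.
Qed.

Lemma bmfun_integrable f : bmfun f -> mu.-integrable setT (EFin \o f).
Proof.
move=> [mf [M fM]]; apply: measurable_bounded_integrable => //.
  exact: le_lt_trans (probability_le1 mu measurableT) (ltry 1).
exists M; split; first exact: num_real.
by move=> N MN x _ /=; rewrite (le_trans (fM x))// ltW.
Qed.

Lemma bm_integral_cst (c : R) : \int[mu]_x c = c.
Proof.
rewrite Rintegral_cst//; rewrite [X in fine X](_ : _ = 1%E) ?mulr1//.
exact: probability_setT.
Qed.

Lemma bm_integralD f g : bmfun f -> bmfun g ->
  \int[mu]_x (f x + g x) = \int[mu]_x f x + \int[mu]_x g x.
Proof. by move=> bf bg; rewrite RintegralD//; exact: bmfun_integrable. Qed.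

Lemma bm_integralB f g : bmfun f -> bmfun g ->
  \int[mu]_x (f x - g x) = \int[mu]_x f x - \int[mu]_x g x.
Proof. by move=> bf bg; rewrite RintegralB//; exact: bmfun_integrable. Qed.

Lemma bm_integralZ (c : R) f : bmfun f ->
  \int[mu]_x (c * f x) = c * \int[mu]_x f x.
Proof. by move=> bf; rewrite RintegralZl//; exact: bmfun_integrable. Qed.

Lemma bm_integral_sum (I : Type) (s : seq I) (F : I -> X -> R) :
  (forall i, bmfun (F i)) ->
  \int[mu]_x (\sum_(i <- s) F i x) = \sum_(i <- s) \int[mu]_x F i x.
Proof.
move=> bF; elim: s => [|i s IHs].
  rewrite big_nil; under eq_Rintegral do rewrite big_nil.
  exact: bm_integral_cst.
rewrite big_cons -IHs -bm_integralD//; last exact: bmfun_sum.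
by apply: eq_Rintegral => x _; rewrite big_cons.
Qed.

Lemma bm_le_integral f g : bmfun f -> bmfun g -> (forall x, f x <= g x) ->
  \int[mu]_x f x <= \int[mu]_x g x.
Proof.
by move=> bf bg fg; apply: le_Rintegral => //; exact: bmfun_integrable.
Qed.

End Bounded.

Arguments bmfun_cst {d X R} c.

Section Dynamics.
Context (d : measure_display) (X : measurableType d) (R : realType).
Variables (mu : probability X R) (T : invertible_mps mu).

Lemma mps_powS (n : int) (x : X) : mps_pow T (n + 1) x = T (mps_pow T n x).
Proof.
case: n => [n|[|n]]; first by rewrite -PoszD addn1.
  by rewrite NegzE addNr /= mps_invK.
have -> : Negz n.+1 + 1 = Negz n by rewrite !NegzE -addn1 PoszD opprD addrNK.
by rewrite /= mps_invK.
Qed.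

Lemma mps_powD (m n : int) (x : X) :
  mps_pow T (m + n) x = mps_pow T m (mps_pow T n x).
Proof.
have S1 (k : int) y : mps_pow T (k - 1) y = mps_inv T (mps_pow T k y).
  by rewrite -{2}[k](subrK 1) mps_powS mps_mapK.
elim/int_rec: m => [|m IHm|m IHm]; first by rewrite add0r.
  by rewrite -addn1 PoszD addrAC mps_powS IHm mps_powS.
by rewrite -addn1 PoszD opprD addrAC S1 IHm S1.
Qed.

Lemma measurable_mps_pow (n : int) : measurable_fun setT (mps_pow T n).
Proof.
have miter (g : X -> X) k : measurable_fun setT g -> measurable_fun setT (iter k g).
  move=> mg; elim: k => [|k IHk]; first exact: measurable_id.
  exact: (measurableT_comp mg IHk).
by case: n => n; apply: miter; [exact: measurable_mps_map|exact: measurable_mps_inv].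
Qed.

Lemma mps_pow_preserving (n : int) (A : set X) :
  measurable A -> mu (mps_pow T n @^-1` A) = mu A.
Proof.
have miter (g : X -> X) k B : measurable_fun setT g ->
    (forall B, measurable B -> mu (g @^-1` B) = mu B) ->
    measurable B -> mu (iter k g @^-1` B) = mu B.
  move=> mg pg; elim: k B => [|k IHk] B mB //.
  have mgB : measurable (g @^-1` B) by rewrite -[_ @^-1` _]setTI; exact: mg.
  by rewrite -(pg _ mB) -(IHk _ mgB).
case: n => n mA; apply: miter => //.
- exact: measurable_mps_map.
- exact: mps_preserving.
- exact: measurable_mps_inv.
move=> B mB.
have mB' : measurable (mps_inv T @^-1` B).
  by rewrite -[_ @^-1` _]setTI; exact: measurable_mps_inv.
rewrite -(mps_preserving T mB'); congr (mu _).
by apply/seteqP; split=> x /=; rewrite mps_mapK.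
Qed.

Lemma bmfun_pow (f : X -> R) n : bmfun f -> bmfun (f \o mps_pow T n).
Proof.
move=> [mf [M fM]]; split; last by exists M => x; exact: fM.
exact: measurableT_comp mf (measurable_mps_pow n).
Qed.

Lemma integral_mps_pow (f : X -> R) n : bmfun f ->
  \int[mu]_x f (mps_pow T n x) = \int[mu]_x f x.
Proof.
move=> bf; rewrite /Rintegral; congr fine.
have := @integral_pushforward _ _ _ _ R _ (measurable_mps_pow n) mu setT
  (EFin \o f) _ _ measurableT.
rewrite preimage_setT => <- //.
- apply: eq_measure_integral; first exact: measurable_mps_pow.
  by move=> mp A mA _; exact: (mps_pow_preserving n mA).
- by apply/measurable_EFinP; case: bf.
- by apply: bmfun_integrable (bmfun_pow _ bf).
Qed.

End Dynamics.

(** * The van der Corput inequality along an idempotent ultrafilter *)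

Section VanDerCorput.
Context (d : measure_display) (X : measurableType d) (R : realType).
Variables (mu : probability X R) (p : set_system posnat).
Hypothesis hp : idempotent_ultrafilter p.

#[local] Instance vdc_filter : ProperFilter p := @ultra_proper _ _ hp.1.

(** Bessel's inequality for almost orthogonal vectors: along a sequence of
    length [N] given by the tower lemma, the square of the sum of the [v m] has
    integral of order [N * K + N ^ 2 * eta], whereas its inner product with [y]
    would be at least [N * e]. *)
Lemma vdc_bessel (v : posnat -> X -> R) (y : X -> R) (K e : R) :
  (forall n, bmfun (v n)) -> bmfun y ->
  (forall n, \int[mu]_x (v n x * v n x) <= K) ->
  (forall eta : R, 0 < eta -> p [set h | p [set m |
     `|\int[mu]_x (v (addposn h m) x * v m x)| <= eta]]) ->
  0 < e -> ~ p [set m | e <= \int[mu]_x (y x * v m x)].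
Proof.
move=> bv by_ vK corr e0 pB.
pose Y := \int[mu]_x (y x * y x).
have Y0 : 0 <= Y by apply: Rintegral_ge0 => x _; rewrite -expr2 sqr_ge0.
pose kap := e / (Y + 1).
have Y1 : 0 < Y + 1 by rewrite ltr_wpDl.
have kap0 : 0 < kap by rewrite divr_gt0.
pose eta := kap * e / 2.
have eta0 : 0 < eta by rewrite divr_gt0// mulr_gt0.
have [N NK] : exists N : nat, K < N%:R * eta.
  exists (Num.bound `|K / eta|); rewrite -ltr_pdivrMr//.
  exact: le_lt_trans (ler_norm _) (archi_boundP (normr_ge0 _)).
have [ms [szms Bms Sms]] :=
  @idempotent_tower p hp N _ (fun a b => `|\int[mu]_x (v a x * v b x)| <= eta)
    pB (corr _ eta0).
pose s l x := \sum_(m <- l) v m x.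
have bs l : bmfun (s l) by exact: bmfun_sum.
have sq l : pairwise (fun a b => `|\int[mu]_x (v a x * v b x)| <= eta) l ->
    \int[mu]_x (s l x * s l x) <= (size l)%:R * K + (size l)%:R ^+ 2 * eta.
  elim: l => [|m l IHl].
    move=> _; rewrite /s; under eq_Rintegral do rewrite big_nil mulr0.
    by rewrite bm_integral_cst expr2 !mul0r addr0.
  move=> /= /andP[ml {}/IHl IHl].
  have cross : \int[mu]_x (v m x * s l x) <= (size l)%:R * eta.
    have -> : \int[mu]_x (v m x * s l x) =
        \sum_(j <- l) \int[mu]_x (v m x * v j x).
      rewrite -bm_integral_sum; last by move=> j; exact: bmfunM.
      by apply: eq_Rintegral => x _; rewrite /s mulr_sumr.
    have -> : (size l)%:R * eta = \sum_(j <- l) eta.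
      by rewrite big_const_seq count_predT iter_addr_0 mulr_natl.
    rewrite big_seq [leRHS]big_seq; apply: ler_sum => j jl.
    by rewrite (le_trans (ler_norm _))// (allP ml).
  have -> : \int[mu]_x (s (m :: l) x * s (m :: l) x) =
      \int[mu]_x (v m x * v m x) + 2 * \int[mu]_x (v m x * s l x) +
      \int[mu]_x (s l x * s l x).
    rewrite -bm_integralZ; last exact: bmfunM.
    rewrite -bm_integralD; [|exact: bmfunM|by apply: bmfunZ; exact: bmfunM].
    rewrite -bm_integralD; last 2 first.
    - by apply: bmfunD; [|apply: bmfunZ]; exact: bmfunM.
    - exact: bmfunM.
    by apply: eq_Rintegral => x _; rewrite /s big_cons; ring.
  rewrite -natr1; have := vK m; move: IHl cross eta0.
  set a := \int[mu]_x _; set b := \int[mu]_x _; set c := \int[mu]_x _.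
  set k := (size l)%:R => *; nra.
have ys : N%:R * e <= \int[mu]_x (y x * s ms x).
  have -> : \int[mu]_x (y x * s ms x) = \sum_(m <- ms) \int[mu]_x (y x * v m x).
    rewrite -bm_integral_sum; last by move=> j; exact: bmfunM.
    by apply: eq_Rintegral => x _; rewrite /s mulr_sumr.
  have -> : N%:R * e = \sum_(j <- ms) e.
    by rewrite big_const_seq count_predT iter_addr_0 szms mulr_natl.
  by rewrite big_seq [leRHS]big_seq; apply: ler_sum => j /Bms.
(* By the choice of [kap] and [eta] the square of [s ms - lam * y] has integral
   at most [N * (K - N * eta)], which is negative by the choice of [N]. *)
pose lam := N%:R * kap.
have pos : 0 <= \int[mu]_x (s ms x * s ms x) -
    2 * lam * \int[mu]_x (y x * s ms x) + lam ^+ 2 * Y.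
  rewrite /Y -!bm_integralZ; try exact: bmfunM.
  rewrite -bm_integralB; [|exact: bmfunM|by apply: bmfunZ; exact: bmfunM].
  rewrite -bm_integralD; last 2 first.
  - by apply: bmfunB; [|apply: bmfunZ]; exact: bmfunM.
  - by apply: bmfunZ; exact: bmfunM.
  apply: Rintegral_ge0 => x _.
  by rewrite (_ : _ + _ = (s ms x - lam * y x) ^+ 2) ?sqr_ge0//; ring.
have kapY : kap * Y <= e.
  by rewrite -[leRHS](divfK (lt0r_neq0 Y1)) -/kap ler_wpM2l ?lerDl// ltW.
have N0 : 0 <= N%:R :> R by exact: ler0n.
have := sq _ Sms; rewrite szms => sqN.
have N1 : 0 < N%:R :> R.
  rewrite lt_neqAle N0 andbT; apply/eqP => N0'.
  have K0 : 0 <= K.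
    have [m _] : [set: posnat] !=set0 by exact: (@filter_ex _ p _ _ filterT).
    by apply: le_trans (vK m); apply: Rintegral_ge0 => x _; rewrite -expr2 sqr_ge0.
  by move: NK; rewrite -N0' mul0r ltNge K0.
have e2 : 2 * lam * (N%:R * e) <= 2 * lam * \int[mu]_x (y x * s ms x).
  by rewrite ler_wpM2l// mulr_ge0// mulr_ge0// ltW.
have e3 : lam ^+ 2 * Y <= N%:R ^+ 2 * kap * e.
  have -> : lam ^+ 2 * Y = N%:R ^+ 2 * kap * (kap * Y) by rewrite /lam; ring.
  by rewrite ler_wpM2l// mulr_ge0 ?sqr_ge0// ltW.
have e4 : N%:R * K < N%:R * (N%:R * eta) by rewrite ltr_pM2l.
have eE : eta * 2 = kap * e by rewrite /eta divfK// pnatr_eq0.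
have : 0 < 0 :> R; last by rewrite ltxx.
rewrite [ltRHS](_ : 0 = N%:R * (N%:R * eta) + N%:R ^+ 2 * eta -
    2 * lam * (N%:R * e) + N%:R ^+ 2 * (eta * 2)); last first.
  by rewrite eE /lam; rewrite (_ : eta = kap * e / 2)//; field.
rewrite eE; lra.
Qed.

(** Apply the Bessel argument to [v n = u n - c]: since the integrals of [u]
    converge to [c], its correlations are asymptotically those of [u] minus
    [c ^+ 2]. *)
Lemma van_der_corput (u : posnat -> X -> R) (M c : R) :
  (forall n, measurable_fun setT (u n)) -> (forall n x, `|u n x| <= M) ->
  (fun n => \int[mu]_x u n x) @ p --> c ->
  (forall e : R, 0 < e -> p [set h | p [set n |
     `|\int[mu]_x (u (addposn h n) x * u n x) - c ^+ 2| < e]]) ->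
  forall y, bmfun y ->
    (fun n => \int[mu]_x (y x * u n x)) @ p --> c * \int[mu]_x y x.
Proof.
move=> mu_ uM uc corr y by_.
have bu n : bmfun (u n) by split=> //; exists M => x.
pose v n x := u n x - c.
have bv n : bmfun (v n) by exact: bmfunB (bu n) (bmfun_cst c).
have vM n x : v n x * v n x <= (M + `|c|) ^+ 2.
  rewrite -expr2 -real_normK ?num_real// lerXn2r ?nnegrE//.
    by rewrite addr_ge0// (le_trans _ (uM n x)).
  by rewrite (le_trans (ler_normB _ _))// lerD2r.
have vK n : \int[mu]_x (v n x * v n x) <= (M + `|c|) ^+ 2.
  rewrite -[leRHS](bm_integral_cst mu); apply: bm_le_integral => //.
    exact: bmfunM.
  exact: bmfun_cst.
have vcorr eta : 0 < eta -> p [set h | p [set m |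
    `|\int[mu]_x (v (addposn h m) x * v m x)| <= eta]].
  move=> eta0.
  (* of the three error terms below one has weight 1 and two have weight |c| *)
  pose e := eta / (1 + 2 * `|c|).
  have c1 : 0 < 1 + 2 * `|c| by rewrite ltr_pwDl// mulr_ge0.
  have e0 : 0 < e by rewrite divr_gt0.
  have /cvgr_dist_lt/(_ _ e0) un := uc.
  have unh := idempotent_near2 hp un.
  apply: filterS (filterI (corr _ e0) unh) => h /= [hcorr hn].
  apply: filterS (filterI (filterI hcorr hn) un) => n /= [[ncorr nh] nn].
  have -> : \int[mu]_x (v (addposn h n) x * v n x) =
      (\int[mu]_x (u (addposn h n) x * u n x) - c ^+ 2) +
      (c * (c - \int[mu]_x u (addposn h n) x) + c * (c - \int[mu]_x u n x)).
    transitivity (\int[mu]_x (u (addposn h n) x * u n x) -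
        c * \int[mu]_x u (addposn h n) x - c * \int[mu]_x u n x + c ^+ 2).
      rewrite -!bm_integralZ// -bm_integralB; [|exact: bmfunM|exact: bmfunZ].
      rewrite -bm_integralB; last 2 first.
      - by apply: bmfunB; [exact: bmfunM|exact: bmfunZ].
      - exact: bmfunZ.
      rewrite -[in RHS](bm_integral_cst mu (c ^+ 2)) -bm_integralD; last 2 first.
      - apply: bmfunB; last exact: bmfunZ.
        by apply: bmfunB; [exact: bmfunM|exact: bmfunZ].
      - exact: bmfun_cst.
      by apply: eq_Rintegral => x _; rewrite /v; ring.
    by ring.
  have -> : eta = e + (`|c| * e + `|c| * e).
    rewrite (_ : eta = (1 + 2 * `|c|) * e); first by ring.
    by rewrite /e mulrC divfK// lt0r_neq0.
  rewrite (le_trans (ler_normD _ _))// lerD//; first exact: ltW.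
  by rewrite (le_trans (ler_normD _ _))// !normrM lerD// ler_wpM2l// ltW.
apply/cvgrPdist_lt => e e0.
have yv n : \int[mu]_x (y x * v n x) = \int[mu]_x (y x * u n x) - c * \int[mu]_x y x.
  rewrite -bm_integralZ// -bm_integralB; [|exact: bmfunM|exact: bmfunZ].
  by apply: eq_Rintegral => x _; rewrite /v; ring.
have [//|pn] := in_ultra_setVsetC
  [set n | `|c * \int[mu]_x y x - \int[mu]_x (y x * u n x)| < e] hp.1.
have [pn1|pn2] : p [set n | e <= \int[mu]_x (y x * v n x)] \/
    p [set n | e <= \int[mu]_x (- y x * v n x)].
- apply: ultra_near_or => //; apply: filterS pn => n /= /negP.
  rewrite -leNgt distrC -yv ler_normr => /orP[?|yvn]; [by left|right] => /=.
  apply: (le_trans yvn); rewrite -mulN1r -bm_integralZ; last exact: bmfunM.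
  by rewrite le_eqVlt; apply/orP; left; apply/eqP; apply: eq_Rintegral => x _; ring.
- by case: (@vdc_bessel v y _ e bv by_ vK vcorr e0).
- by case: (@vdc_bessel v _ _ e bv (bmfunN by_) vK vcorr e0).
Qed.

End VanDerCorput.

(** * Weak convergence of complex functions *)

Section WeakLimit.
Context (d : measure_display) (X : measurableType d) (R : realType).
Variable mu : probability X R.

Let normc := @ComplexField.Normc.normc R.

Let norm_normc (z : R[i]) : `|z| = ((normc z)%:C)%C.
Proof. by []. Qed.

(** The norm of [R[i]] takes its values in [R[i]], whose positive elements are
    exactly the positive reals. *)
Lemma normc_lt_cvg (T : Type) (F : set_system T) (u : T -> R[i]) (l : R[i]) :
  Filter F ->
  ((u : T -> R[i]^o) @ F --> (l : R[i]^o)) <->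
  (forall e : R, 0 < e -> F [set n | normc (u n - l) < e]).
Proof.
move=> FF; split=> [/cvgrPdist_lt ul e e0|ul].
  have /ul : 0 < (e%:C)%C by rewrite ltcR.
  by apply: filterS => n; rewrite distrC norm_normc ltcR.
apply/cvgrPdist_lt => -[e e'] /[1!ltcE] /= /andP[/eqP-> e0].
near=> n; rewrite distrC norm_normc ltcE /= eqxx /=.
by near: n; exact: ul.
Unshelve. all: by end_near. Qed.

Lemma weak_plimP (p : set_system posnat) (u : posnat -> X -> R[i])
    (f : X -> R[i]) : Filter p ->
  weak_plim mu p u f <->
  (forall g, cLfun mu 2%:E g -> forall e : R, 0 < e ->
    p [set n | normc (cinner mu (u n) g - cinner mu f g) < e]).
Proof.
move=> Fp; split=> [uf g g2|uf].
  apply/normc_lt_cvg.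
  have c1 : @weak_eval d X R mu \o u @ p --> @weak_eval d X R mu f.
    by apply: cvg_comp uf _; exact: initial_continuous.
  move/cvg_sup/(_ (exist _ g g2)) in c1.
  exact: (cvg_comp _ _ c1 (@initial_continuous _ _
    (fun w : cL2 mu -> R[i]^o => w (exist _ g g2)) (@weak_eval d X R mu f))).
have c1 : @weak_eval d X R mu \o u @ p --> @weak_eval d X R mu f.
  apply/cvg_sup => -[g g2] A /= [_ [[B oB <-] Bf] BA].
  have /normc_lt_cvg/(_ B) := uf g g2.
  have nB : nbhs (cinner mu f g : R[i]^o) B by exact: open_nbhs_nbhs.
  by move=> /(_ nB); apply: (@filterS _ p) => n; exact: BA.
move=> A /= [_ [[B oB <-] Bf] BA].
have /c1 : nbhs (@weak_eval d X R mu f) B by exact: open_nbhs_nbhs.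
by apply: (@filterS _ p) => n; exact: BA.
Qed.

End WeakLimit.

(** * Mild mixing for bounded real functions *)

Section MildMixingReal.
Context (d : measure_display) (X : measurableType d) (R : realType).
Variables (mu : probability X R) (T : invertible_mps mu).

Lemma bmfun_Lfun2 (f : X -> R) : bmfun f -> f \in Lfun mu 2%:E.
Proof.
move=> [mf [M fM]]; apply: (@Lfun_subset _ _ _ mu 2%:E +oo%E);
  rewrite ?leey ?lee_fin ?ler1n//.
  exact: fin_num_measure.
rewrite inE; apply/andP; split; rewrite inE//= /finite_norm unlock /=.
case: ifP => _; last exact: ltry.
apply: (@le_lt_trans _ _ M%:E); last exact: ltry.
by apply/ess_supP/nearW => x /=; rewrite lee_fin.
Qed.

Lemma bmfun_cLfun2 (f : X -> R) : bmfun f -> cLfun mu 2%:E (fun x => (f x)%:C%C).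
Proof.
move=> bf; split => /=; [by case: bf|exact: measurable_cst|].
under eq_fun do rewrite /= expr0n addr0 sqrtr_sqr.
apply: bmfun_Lfun2; case: bf => mf [M fM]; split.
  exact: measurableT_comp.
by exists M => x; rewrite normr_id.
Qed.

Lemma cintegral_real (f : X -> R) :
  cintegral mu (fun x => (f x)%:C%C) = (\int[mu]_x f x)%:C%C.
Proof. by rewrite /cintegral /= bm_integral_cst. Qed.

Hypothesis hT : mildly_mixing T.

Lemma mildly_mixing_real (p : set_system posnat) (f g : X -> R) :
  idempotent_ultrafilter p -> bmfun f -> bmfun g ->
  (fun n => \int[mu]_x (f (mps_pow T (Posz (val n)) x) * g x)) @ p -->
    (\int[mu]_x f x) * (\int[mu]_x g x).
Proof.
move=> hp bf bg; have FF : ProperFilter p := @ultra_proper _ _ hp.1.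
have /weak_plimP/(_ _ (bmfun_cLfun2 bg)) pl := hT (bmfun_cLfun2 bf) hp.
apply/cvgrPdist_lt => e /pl; apply: (@filterS _ p) => n; rewrite /mkset; cbv beta.
have conjR (r : R) : conjc r%:C%C = r%:C%C by rewrite /conjc /= oppr0.
have -> : cinner mu (koopman T (val n) (fun x => (f x)%:C%C))
    (fun x => (g x)%:C%C) =
    (\int[mu]_x (f (mps_pow T (Posz (val n)) x) * g x))%:C%C.
  rewrite -cintegral_real /cinner; congr (cintegral _ _); apply/funext => x.
  by rewrite /koopman conjR rmorphM.
have -> : cinner mu (fun=> cintegral mu (fun x => (f x)%:C%C))
    (fun x => (g x)%:C%C) = ((\int[mu]_x f x) * (\int[mu]_x g x))%:C%C.
  rewrite -bm_integralZ// -[RHS]cintegral_real /cinner cintegral_real.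
  by congr (cintegral _ _); apply/funext => x; rewrite conjR rmorphM.
by rewrite -rmorphB /= expr0n addr0 sqrtr_sqr distrC.
Qed.

(** For [a > 0] the ultrafilter [a * p] is again idempotent; for [a < 0] the
    power of [T] is moved to the other function. *)
Lemma mildly_mixing_pow (p : set_system posnat) (a : int) (f g : X -> R) :
  idempotent_ultrafilter p -> a != 0 -> bmfun f -> bmfun g ->
  (fun h => \int[mu]_x (f (mps_pow T (a * Posz (val h)) x) * g x)) @ p -->
    (\int[mu]_x f x) * (\int[mu]_x g x).
Proof.
move=> hp a0 bf bg.
have pos (k : nat) (f' g' : X -> R) : bmfun f' -> bmfun g' ->
    (fun h => \int[mu]_x (f' (mps_pow T (Posz k.+1 * Posz (val h)) x) * g' x)) @ p -->
    (\int[mu]_x f' x) * (\int[mu]_x g' x).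
  move=> bf' bg'; pose b : posnat := exist _ k.+1 (ltn0Sn k).
  exact: (mildly_mixing_real (idempotent_mul b hp) bf' bg').
case: a a0 => [[//|k]|k] a0; first exact: pos.
rewrite mulrC; have := pos k _ _ bg bf; apply: cvg_trans.
have FF : ProperFilter p := @ultra_proper _ _ hp.1.
apply/near_eq_cvg/nearW => h.
rewrite -(integral_mps_pow T (Negz k * Posz (val h))); last first.
  by apply: bmfunM => //; exact: (bmfun_pow T _ bg).
apply: eq_Rintegral => x _.
by rewrite -mps_powD -mulrDl NegzE subrr mul0r /= mulrC.
Qed.

End MildMixingReal.

(** * Polynomial families over a mildly mixing system *)

Section PolynomialFamily.
Context (d : measure_display) (X : measurableType d) (R : realType).
Variables (mu : probability X R) (T : invertible_mps mu).

Definition poly_family : Type := seq ({poly int} * (X -> R)).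

Implicit Types (l : poly_family) (n h : posnat).

Definition family_prod l n (x : X) : R :=
  \prod_(a <- l) a.2 (mps_pow T a.1.[Posz (val n)] x).

Definition family_bm l : Prop := {in l, forall a, bmfun a.2}.

Lemma family_prod_bound l : family_bm l ->
  exists M, forall n x, `|family_prod l n x| <= M.
Proof.
elim: l => [|a l IHl] bl.
  by exists 1 => n x; rewrite /family_prod big_nil normr1.
have [|M hM] := IHl; first by move=> b bl'; apply: bl; rewrite inE bl' orbT.
have [_ [N hN]] := bl _ (mem_head _ _).
exists (N * M) => n x; rewrite /family_prod big_cons normrM ler_pM//.
exact: hM.
Qed.

Lemma bmfun_family l n : family_bm l -> bmfun (family_prod l n).
Proof.
move=> bl; apply: bmfun_prod => a al.
exact: (bmfun_pow T a.1.[Posz (val n)] (bl _ al)).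
Qed.

Definition family_shift (P : {poly int}) l : poly_family :=
  [seq (b.1 - P, b.2) | b <- l].

(** By invariance of the measure one member of the family may be frozen; the
    others are then read along the differences. *)
Lemma integral_family_cons (a : {poly int} * (X -> R)) l n :
  family_bm (a :: l) ->
  \int[mu]_x family_prod (a :: l) n x =
  \int[mu]_x (a.2 x * family_prod (family_shift a.1 l) n x).
Proof.
move=> bl; rewrite -(integral_mps_pow T (- a.1.[Posz (val n)])); last first.
  exact: bmfun_family.
apply: eq_Rintegral => x _; rewrite /family_prod big_cons big_map /=.
rewrite -mps_powD subrr /=; congr (_ * _); apply: eq_bigr => b _.
by rewrite -mps_powD hornerD hornerN.
Qed.

Definition family_double h l : poly_family :=
  flatten [seq if size a.1 == 2%N
    then [:: (a.1, fun x => a.2 (mps_pow T (a.1`_1 * Posz (val h)) x) * a.2 x)]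
    else [:: a; (translate h a.1, a.2)] | a : {poly int} * (X -> R) <- l].

Lemma unzip1_family_double h l :
  unzip1 (family_double h l) = doubled h (unzip1 l).
Proof.
rewrite /family_double /doubled; elim: l => [//|a l IHl] /=.
by rewrite /unzip1 map_cat -/unzip1 IHl; case: ifP.
Qed.

Lemma family_double_bm h l : family_bm l -> family_bm (family_double h l).
Proof.
move=> bl b /flatten_mapP[a al]; have ba := bl _ al.
case: ifP => _; rewrite !inE.
  by move=> /eqP->; exact: bmfunM (bmfun_pow T _ ba) ba.
by case/orP => /eqP->.
Qed.

Lemma horner_affine (P : {poly int}) (x y : int) : size P = 2%N ->
  P.[x + y] = P`_1 * x + P.[y].
Proof.
move=> sP; rewrite !horner_coef sP !big_ord_recl !big_ord0 /= /bump /=.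
by rewrite !expr0 !expr1 !mulr1 !addr0 addrCA mulrDr.
Qed.

Lemma family_prod_double h l n x :
  family_prod (family_double h l) n x =
  family_prod l (addposn h n) x * family_prod l n x.
Proof.
rewrite /family_prod /family_double; elim: l => [|a l IHl] /=.
  by rewrite !big_nil mulr1.
rewrite big_cat IHl !big_cons /= mulrACA; congr (_ * _).
case: ifP => [/eqP sa|_]; rewrite !big_cons big_nil mulr1 /=.
  by rewrite PoszD horner_affine// mps_powD.
by rewrite horner_translate PoszD mulrC addrC.
Qed.

Lemma integral_prod_double h l :
  \prod_(b <- family_double h l) \int[mu]_x b.2 x =
  \prod_(a <- l) (if size a.1 == 2%N
    then \int[mu]_x (a.2 (mps_pow T (a.1`_1 * Posz (val h)) x) * a.2 x)
    else (\int[mu]_x a.2 x) ^+ 2).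
Proof.
rewrite /family_double; elim: l => [|a l IHl] /=; first by rewrite !big_nil.
rewrite big_cat IHl !big_cons; congr (_ * _).
by case: ifP => _; rewrite !big_cons big_nil /= mulr1 ?expr2.
Qed.

Hypothesis hT : mildly_mixing T.
Variable p : set_system posnat.
Hypothesis hp : idempotent_ultrafilter p.

#[local] Instance family_filter : ProperFilter p := @ultra_proper _ _ hp.1.

Lemma cvg_eq_fun (u v : posnat -> R) (c : R) :
  u =1 v -> v @ p --> c -> u @ p --> c.
Proof. by move=> /funext->. Qed.

(** Only the affine members depend on [h], each through the correlation of its
    function with a power of [T] whose exponent is a nonzero multiple of [h]. *)
Lemma cvg_integral_double l : family_bm l ->
  (fun h => \prod_(b <- family_double h l) \int[mu]_x b.2 x) @ p -->
    (\prod_(a <- l) \int[mu]_x a.2 x) ^+ 2.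
Proof.
move=> bl; apply: cvg_eq_fun => [h|]; first exact: integral_prod_double.
rewrite -prodrXl big_seq; apply: cvg_eq_fun => [h|]; first exact: big_seq.
apply: cvg_big => [|a al]; first exact: mul_continuous.
have ba := bl _ al.
have [sa|_] := eqVneq (size a.1) 2%N; last exact: cvg_cst.
rewrite expr2; apply: mildly_mixing_pow => //.
have : lead_coef a.1 != 0 by rewrite lead_coef_eq0 -size_poly_gt0 sa.
by rewrite lead_coefE sa.
Qed.

(** Polynomial exhaustion: for a family with a member [a] of minimal degree, the
    van der Corput lemma asks for the integrals of the products along the family
    itself and along its doubled families. All of these contain [a.1], and once
    this member is frozen their weight is smaller. *)
Theorem mildly_mixing_family l (y : X -> R) :
  {in unzip1 l, forall P : {poly int}, (1 < size P)%N} ->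
  pairwise distinct (unzip1 l) ->
  family_bm l -> bmfun y ->
  (fun n => \int[mu]_x (y x * family_prod l n x)) @ p -->
    (\prod_(a <- l) \int[mu]_x a.2 x) * \int[mu]_x y x.
Proof.
have [D] : exists D, {in unzip1 l, forall P : {poly int}, (size P < D)%N}.
  exists (\max_(P <- unzip1 l) size (P : {poly int})).+1 => P Pl.
  by rewrite ltnS; exact: (@leq_bigmax_seq _ _ _ (fun P : {poly int} => size P) P).
move: {2}(weight (unzip1 l)) (erefl (weight (unzip1 l))) => w.
elim/(@weight_ind D): w l y => w IHw l y wl lD l1 dl bl by_.
have [->|l0] := eqVneq l [::].
  rewrite big_nil mul1r; apply: cvg_eq_fun => [n|]; last exact: cvg_cst.
  by apply: eq_Rintegral => x _; rewrite /family_prod big_nil mulr1.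
have [a [al amin]] : exists a : {poly int} * (X -> R), a \in l /\
    {in l, forall b : {poly int} * (X -> R), (size a.1 <= size b.1)%N}.
  case: l l0 {wl lD l1 dl bl} => // b l _; elim: l b => [|c l IHl] b.
    by exists b; rewrite mem_head; split=> // c; rewrite inE => /eqP->.
  have [a [al amin]] := IHl c.
  have [ab|ba] := leqP (size a.1) (size b.1).
    exists a; split; first by rewrite inE al orbT.
    by move=> e; rewrite inE => /predU1P[->|/amin].
  exists b; rewrite mem_head; split=> // e; rewrite inE => /predU1P[->//|el].
  by rewrite (leq_trans (ltnW ba))// amin.
have Pmin : {in unzip1 l, forall Q : {poly int}, (size a.1 <= size Q)%N}.
  by move=> _ /mapP[b bl' ->]; exact: amin.
have aP : a.1 \in unzip1 l by exact: map_f.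
(* The degrees and leading coefficients of a family determine its weight, so
   the induction hypothesis applies, once the head is frozen, to every family
   that has [a.1] as its head and brings no new pair of these. *)
have step (b : {poly int} * (X -> R)) (m : poly_family) :
    b.1 = a.1 -> family_bm (b :: m) -> pairwise distinct (unzip1 (b :: m)) ->
    (forall Q : {poly int}, Q \in unzip1 (b :: m) -> exists2 P, P \in unzip1 l &
      size Q = size P /\ lead_coef Q = lead_coef P) ->
    (fun n => \int[mu]_x family_prod (b :: m) n x) @ p -->
      \prod_(c <- b :: m) \int[mu]_x c.2 x.
  move=> ba bbm /= /andP[/allP db dm] lm.
  apply: cvg_eq_fun => [n|]; first exact: integral_family_cons.
  rewrite big_cons mulrC.
  have -> : \prod_(c <- m) \int[mu]_x c.2 x =
      \prod_(c <- family_shift b.1 m) \int[mu]_x c.2 x by rewrite big_map.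
  have us : unzip1 (family_shift b.1 m) = [seq Q - a.1 | Q <- unzip1 m].
    by rewrite /unzip1 /family_shift -!map_comp -ba; apply: eq_map.
  have lm' Q : Q \in unzip1 m -> exists2 P, P \in unzip1 l &
      size Q = size P /\ lead_coef Q = lead_coef P.
    by move=> Qm; apply: lm; rewrite inE Qm orbT.
  apply: (IHw (weight (unzip1 (family_shift b.1 m)))) => //.
  - rewrite -wl us; apply: (weight_sub aP Pmin).
      by rewrite lD// andbT (leq_trans _ (l1 _ aP)).
    by move=> _ /mapP[Q Qm ->]; rewrite subrK; exact: lm'.
  - rewrite us => _ /mapP[Q /lm'[P Pl [sQ _]] ->].
    by rewrite (leq_ltn_trans (size_polyD _ _))// size_polyN gtn_max sQ !lD.
  - rewrite us => _ /mapP[Q Qm ->].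
    by rewrite -ba; have := db _ Qm; rewrite distinctC.
  - rewrite us pairwise_map; apply: sub_pairwise dm => P Q /=.
    by rewrite distinctB.
  - move=> _ /mapP[c cm ->] /=; apply: bbm; by rewrite inE cm orbT.
  - by apply: bbm; exact: mem_head.
have pl := perm_to_rem al; set l' := rem a l in pl.
have ul : perm_eq (unzip1 l) (unzip1 (a :: l')) by exact: perm_map.
have dl' := perm_pairwise_distinct ul dl.
have bl' : family_bm (a :: l') by move=> b; rewrite -(perm_mem pl); exact: bl.
have -> : \prod_(b <- l) \int[mu]_x b.2 x =
    \prod_(b <- a :: l') \int[mu]_x b.2 x.
  exact: perm_big.
have fE n x : family_prod l n x = family_prod (a :: l') n x by exact: perm_big.
apply: cvg_eq_fun => [n|].
  by apply: eq_Rintegral => x _; rewrite fE.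
have [M hM] := family_prod_bound bl'.
apply: (van_der_corput hp (M := M)) => //.
- by move=> n; case: (bmfun_family n bl').
- apply: step => // Q; rewrite -(perm_mem ul) => Ql; by exists Q.
move=> e e0; have e2 : 0 < e / 2 by rewrite divr_gt0.
have /cvgr_dist_lt/(_ _ e2) pc := cvg_integral_double bl'.
have l1' : {in unzip1 (a :: l'), forall P : {poly int}, (1 < size P)%N}.
  by move=> P; rewrite -(perm_mem ul); exact: l1.
apply: filterS (filterI pc (idempotent_near_doubled hp l1' dl')) => h /= [hc hd].
have [b [m [dE ba]]] : exists b m, family_double h (a :: l') = b :: m /\ b.1 = a.1.
  by rewrite /family_double /=; case: ifP => _ /=; do 2 eexists.
have : (fun n => \int[mu]_x family_prod (family_double h (a :: l')) n x) @ p -->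
    \prod_(c <- family_double h (a :: l')) \int[mu]_x c.2 x.
  rewrite dE; apply: step => //; rewrite -dE.
  - exact: family_double_bm.
  - by rewrite unzip1_family_double.
  move=> Q; rewrite unzip1_family_double => /mem_doubled[P].
  by rewrite -(perm_mem ul) => Pl sP; exists P.
move/cvgr_dist_lt/(_ _ e2); apply: filterS => n /=.
under eq_Rintegral do rewrite family_prod_double.
move=> hn; rewrite [ltRHS]splitr distrC.
by rewrite (le_lt_trans (ler_distD _ _ _) (ltrD hc hn)).
Qed.

End PolynomialFamily.

(** * Complex functions *)

Section ComplexIntegral.
Context (d : measure_display) (X : measurableType d) (R : realType).
Variable mu : probability X R.
Implicit Types F G : X -> R[i].

Let normc := @ComplexField.Normc.normc R.

Definition cmeasurable F : Prop :=
  measurable_fun setT (fun x => complex.Re (F x)) /\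
  measurable_fun setT (fun x => complex.Im (F x)).

Definition cintegrable F : Prop :=
  mu.-integrable setT (EFin \o (fun x => complex.Re (F x))) /\
  mu.-integrable setT (EFin \o (fun x => complex.Im (F x))).

Lemma ReM (a b : R[i]) : complex.Re (a * b) =
  complex.Re a * complex.Re b - complex.Im a * complex.Im b.
Proof. by case: a b => [? ?] [? ?]. Qed.

Lemma ImM (a b : R[i]) : complex.Im (a * b) =
  complex.Re a * complex.Im b + complex.Im a * complex.Re b.
Proof. by case: a b => [? ?] [? ?]. Qed.

Lemma ReD (a b : R[i]) : complex.Re (a + b) = complex.Re a + complex.Re b.
Proof. by case: a b => [? ?] [? ?]. Qed.

Lemma ImD (a b : R[i]) : complex.Im (a + b) = complex.Im a + complex.Im b.
Proof. by case: a b => [? ?] [? ?]. Qed.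

Lemma eq_cintegral F G : F =1 G -> cintegral mu F = cintegral mu G.
Proof. by move=> /funext->. Qed.

Lemma integrableD_R (f g : X -> R) : mu.-integrable setT (EFin \o f) ->
  mu.-integrable setT (EFin \o g) ->
  mu.-integrable setT (EFin \o (fun x => f x + g x)).
Proof. by move=> fi gi; have := integrableD measurableT fi gi; exact. Qed.

Lemma integrableZ_R (c : R) (f : X -> R) : mu.-integrable setT (EFin \o f) ->
  mu.-integrable setT (EFin \o (fun x => c * f x)).
Proof. by move=> fi; have := integrableZl measurableT c fi; exact. Qed.

Lemma cintegrableD F G : cintegrable F -> cintegrable G ->
  cintegrable (fun x => F x + G x).
Proof.
move=> [Fr Fi] [Gr Gi]; split.
  by under eq_fun do rewrite ReD; exact: integrableD_R.
by under eq_fun do rewrite ImD; exact: integrableD_R.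
Qed.

Lemma cintegralD F G : cintegrable F -> cintegrable G ->
  cintegral mu (fun x => F x + G x) = cintegral mu F + cintegral mu G.
Proof.
move=> [Fr Fi] [Gr Gi]; rewrite /cintegral.
under eq_Rintegral do rewrite ReD.
under [X in Complex _ X]eq_Rintegral do rewrite ImD.
by rewrite !RintegralD.
Qed.

Lemma cintegrableZ (c : R[i]) F : cintegrable F -> cintegrable (fun x => c * F x).
Proof.
move=> [Fr Fi]; split.
  under eq_fun do rewrite ReM -mulNr.
  by apply: integrableD_R; exact: integrableZ_R.
under eq_fun do rewrite ImM.
by apply: integrableD_R; exact: integrableZ_R.
Qed.

Lemma cintegralZ (c : R[i]) F : cintegrable F ->
  cintegral mu (fun x => c * F x) = c * cintegral mu F.
Proof.
move=> [Fr Fi]; rewrite /cintegral.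
under eq_Rintegral do rewrite ReM -mulNr.
under [X in Complex _ X]eq_Rintegral do rewrite ImM.
rewrite !RintegralD//; try exact: integrableZ_R.
by rewrite !RintegralZl// mulNr; case: (c).
Qed.

Lemma cintegral_sum (I : Type) (s : seq I) (F : I -> X -> R[i]) :
  (forall i, cintegrable (F i)) ->
  cintegrable (fun x => \sum_(i <- s) F i x) /\
  cintegral mu (fun x => \sum_(i <- s) F i x) = \sum_(i <- s) cintegral mu (F i).
Proof.
move=> Fi; elim: s => [|i s [IHi IHs]].
  rewrite big_nil (_ : (fun x => _) = fun=> 0); last first.
    by apply/funext => x; rewrite big_nil.
  split; last by rewrite /cintegral /= bm_integral_cst.
  by split; apply: bmfun_integrable; exact: bmfun_cst.
rewrite big_cons (_ : (fun x => _) = fun x => F i x + \sum_(j <- s) F j x).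
  by split; [exact: cintegrableD | rewrite cintegralD// IHs].
by apply/funext => x; rewrite big_cons.
Qed.

Lemma cintegrable_real (f : X -> R) : mu.-integrable setT (EFin \o f) ->
  cintegrable (fun x => (f x)%:C%C).
Proof. by move=> fi; split=> //=; apply: bmfun_integrable; exact: bmfun_cst. Qed.

(** A complex number is a combination of two reals with coefficients indexed by
    a boolean; in this form products of complex functions expand by
    distributivity into products of real ones. *)
Definition cunit (b : bool) : R[i] := if b then 1 else 'i%C.
Definition cpart (b : bool) (z : R[i]) : R :=
  if b then complex.Re z else complex.Im z.

Lemma cpartE (z : R[i]) : z = \sum_(b : bool) cunit b * (cpart b z)%:C%C.
Proof. by rewrite big_bool /= mul1r [LHS]complexE. Qed.

Lemma cmeasurableM F G : cmeasurable F -> cmeasurable G ->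
  cmeasurable (fun x => F x * G x).
Proof.
move=> [Fr Fi] [Gr Gi]; split.
  under eq_fun do rewrite ReM.
  by apply: measurable_funB; exact: measurable_funM.
under eq_fun do rewrite ImM.
by apply: measurable_funD; exact: measurable_funM.
Qed.

Lemma cmeasurable_prod (I : Type) (s : seq I) (F : I -> X -> R[i]) :
  (forall i, cmeasurable (F i)) -> cmeasurable (fun x => \prod_(i <- s) F i x).
Proof.
move=> mF; elim: s => [|i s IHs].
  rewrite (_ : (fun x => _) = fun=> 1); first by split; exact: measurable_cst.
  by apply/funext => x; rewrite big_nil.
rewrite (_ : (fun x => _) = fun x => F i x * \prod_(j <- s) F j x).
  exact: cmeasurableM.
by apply/funext => x; rewrite big_cons.
Qed.

Lemma ae_eq_cintegral F G : cmeasurable F -> cmeasurable G ->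
  (\forall x \ae mu, F x = G x) -> cintegral mu F = cintegral mu G.
Proof.
move=> [Fr Fi] [Gr Gi] FG; rewrite /cintegral /Rintegral.
congr (Complex (fine _) (fine _)).
  apply: ae_eq_integral => //; [exact/measurable_EFinP|exact/measurable_EFinP|].
  by apply: filterS FG => x -> _.
apply: ae_eq_integral => //; [exact/measurable_EFinP|exact/measurable_EFinP|].
by apply: filterS FG => x -> _.
Qed.

Lemma Re_le_normc (z : R[i]) : `|complex.Re z| <= normc z.
Proof.
case: z => a b /=; rewrite -sqrtr_sqr ler_wsqrtr// lerDl sqr_ge0//.
Qed.

Lemma Im_le_normc (z : R[i]) : `|complex.Im z| <= normc z.
Proof.
case: z => a b /=; rewrite -sqrtr_sqr ler_wsqrtr// lerDr sqr_ge0//.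
Qed.

Lemma cLfun2_cintegrable F : cLfun mu 2%:E F -> cintegrable F.
Proof.
move=> [mr mi L2].
have L1 : (fun x => normc (F x)) \in Lfun mu 1.
  apply: Lfun_subset12 L2; exact: fin_num_measure.
move/Lfun1_integrable in L1.
split; apply: le_integrable L1 => //; try exact/measurable_EFinP.
  by move=> x _ /=; rewrite lee_fin (le_trans (Re_le_normc _))// ler_norm.
by move=> x _ /=; rewrite lee_fin (le_trans (Im_le_normc _))// ler_norm.
Qed.

Lemma cLfunoo_bounded F : cLfun mu +oo%E F ->
  exists C, \forall x \ae mu, normc (F x) <= C.
Proof.
move=> [mr mi]; rewrite inE => /andP[_]; rewrite inE /= /finite_norm unlock /=.
have -> : (0 < mu [set: X])%E by rewrite probability_setT lte01.
move=> /ess_supr_bounded[C hC]; exists C.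
apply: filterS hC => x; rewrite /= ger0_norm//.
by case: (F x) => a b /=; rewrite sqrtr_ge0.
Qed.

End ComplexIntegral.

(** * From bounded real functions to the general statement *)

Section Extension.
Import HBSimple.

Context (d : measure_display) (X : measurableType d) (R : realType).
Variables (mu : probability X R) (T : invertible_mps mu).
Hypothesis hT : mildly_mixing T.
Variables (k : nat) (P : 'I_k -> {poly int}).
Hypothesis hP0 : forall i : 'I_k, (1 < size (P i))%N.
Hypothesis hP : forall i j : 'I_k, i != j -> (1 < size (P i - P j)%R)%N.
Variable p : set_system posnat.
Hypothesis hp : idempotent_ultrafilter p.

#[local] Instance extension_filter : ProperFilter p := @ultra_proper _ _ hp.1.

Let orbit (n : posnat) (i : 'I_k) : X -> X := mps_pow T (P i).[Posz (val n)].

Let fam (f : 'I_k -> X -> R) : poly_family X R := [seq (P i, f i) | i <- enum 'I_k].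

Lemma fam_prodE (f : 'I_k -> X -> R) n x :
  family_prod T (fam f) n x = \prod_(i < k) f i (orbit n i x).
Proof. by rewrite /family_prod /fam big_map big_enum. Qed.

Lemma fam_bm (f : 'I_k -> X -> R) : (forall i, bmfun (f i)) -> family_bm (fam f).
Proof. by move=> bf _ /mapP[i _ ->]; exact: bf. Qed.

Lemma cvg_real_bounded (f : 'I_k -> X -> R) (y : X -> R) :
  (forall i, bmfun (f i)) -> bmfun y ->
  (fun n => \int[mu]_x (y x * \prod_(i < k) f i (orbit n i x))) @ p -->
    (\prod_(i < k) \int[mu]_x f i x) * \int[mu]_x y x.
Proof.
move=> bf by_.
have uz : unzip1 (fam f) = [seq P i | i <- enum 'I_k] by rewrite /unzip1 -map_comp.
apply: cvg_eq_fun => [n|].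
  by apply: eq_Rintegral => x _; rewrite -fam_prodE.
have -> : \prod_(i < k) \int[mu]_x f i x = \prod_(a <- fam f) \int[mu]_x a.2 x.
  by rewrite /fam big_map big_enum.
apply: mildly_mixing_family => //; last exact: fam_bm.
  by rewrite uz => _ /mapP[i _ ->].
rewrite uz pairwise_map.
have : pairwise [rel i j : 'I_k | i != j] (enum 'I_k).
  by rewrite -uniq_pairwise enum_uniq.
by apply: sub_pairwise => i j; exact: hP.
Qed.

(** The products along the orbits are bounded uniformly in [n], so that the
    test function may be approximated in [L^1] by simple functions. *)
Lemma cvg_real_integrable (f : 'I_k -> X -> R) (y : X -> R) :
  (forall i, bmfun (f i)) -> mu.-integrable setT (EFin \o y) ->
  (fun n => \int[mu]_x (y x * \prod_(i < k) f i (orbit n i x))) @ p -->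
    (\prod_(i < k) \int[mu]_x f i x) * \int[mu]_x y x.
Proof.
move=> bf yi; set c := \prod_(i < k) _.
pose u n x := \prod_(i < k) f i (orbit n i x).
have bu n : bmfun (u n).
  have := bmfun_family T n (fam_bm bf).
  by rewrite (_ : family_prod _ _ _ = u n)//; apply/funext => x; exact: fam_prodE.
have [M uM] : exists M : R, forall n x, `|u n x| <= M.
  have [M hM] := family_prod_bound T (fam_bm bf).
  by exists M => n x; rewrite /u -fam_prodE.
have [n0 _] : [set: posnat] !=set0 by exact: (@filter_ex _ p _ _ filterT).
have prob : (0 < mu [set: X])%E by rewrite probability_setT lte01.
have M0 : 0 <= M.
  have /set0P[x _] : [set: X] != set0.
    by apply/eqP => X0; move: prob; rewrite X0 measure0 ltxx.
  exact: le_trans (normr_ge0 _) (uM n0 x).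
have Mc0 : 0 < M + `|c| + 1 by rewrite ltr_wpDl// addr_ge0.
apply/cvgrPdist_lt => e e0.
have e2 : 0 < e / 2 / (M + `|c| + 1) by rewrite !divr_gt0.
have [g [bg gy]] : exists g, bmfun g /\
    \int[mu]_x `|y x - g x| < e / 2 / (M + `|c| + 1).
  have [g_ [gi _ gl]] := approximation_sfun_integrable measurableT yi.
  have /fine_cvgP[_ /cvgrPdist_lt/(_ _ e2)] := gl.
  move=> /(@filter_ex _ _ _) [n]; rewrite /= sub0r normrN => hn.
  exists (fun x => g_ n x); split; last exact: le_lt_trans (ler_norm _) hn.
  split; first exact: measurable_funP.
  have [C [_ hC]] := simple_bounded (g_ n).
  by exists (C + 1) => x; apply: hC => //; rewrite ltrDl.
have /cvgr_dist_lt/(_ _ (divr_gt0 e0 (ltr0Sn _ 1))) := cvg_real_bounded bf bg.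
apply: filterS => n /=; rewrite -/c -/(u n) => hn.
have gi := bmfun_integrable mu bg.
have ygi : mu.-integrable setT (EFin \o (fun x => y x - g x)).
  by have := integrableB measurableT yi gi; exact.
have mulu (h : X -> R) : mu.-integrable setT (EFin \o h) ->
    mu.-integrable setT (EFin \o (fun x => h x * u n x)).
  move=> hi; have [mu_ _] := bu n.
  have bdu : [bounded u n x | x in setT].
    exists M; split; first exact: num_real.
    by move=> N MN x _ /=; rewrite (le_trans (uM n x))// ltW.
  by have := integrableMl measurableT hi mu_ bdu; exact.
pose dlt := \int[mu]_x `|y x - g x|.
have d1 : `|\int[mu]_x (y x * u n x) - \int[mu]_x (g x * u n x)| <= dlt * M.
  rewrite -RintegralB//; [|exact: mulu|exact: mulu].
  have dui : mu.-integrable setT (EFin \o (fun x => y x * u n x - g x * u n x)).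
    by have := integrableB measurableT (mulu _ yi) (mulu _ gi); exact.
  rewrite (le_trans (le_normr_Rintegral measurableT dui))// -RintegralZr//; last first.
    exact: integrable_norm ygi.
  apply: le_Rintegral => //; first exact: integrable_norm dui.
    have := integrableZr measurableT M (integrable_norm ygi).
    by exact.
  by move=> x _; rewrite -mulrBl normrM ler_wpM2l.
have d2 : `|\int[mu]_x y x - \int[mu]_x g x| <= dlt.
  rewrite -RintegralB//; exact: le_normr_Rintegral.
have d3 : dlt * (M + `|c| + 1) < e / 2 by rewrite -ltr_pdivlMr.
have dlt0 : 0 <= dlt by apply: Rintegral_ge0.
rewrite (_ : c * _ - _ = c * (\int[mu]_x y x - \int[mu]_x g x) +
  (c * \int[mu]_x g x - \int[mu]_x (g x * u n x)) -
  (\int[mu]_x (y x * u n x) - \int[mu]_x (g x * u n x))); last by ring.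
rewrite (le_lt_trans (ler_normB _ _))//.
rewrite (le_lt_trans (lerD (ler_normD _ _) d1))// normrM.
have := ler_wpM2l (normr_ge0 c) d2; move: hn d3; set A := `|_|; set B := `|c|.
lra.
Qed.

(** Expanding every factor into its real and imaginary part reduces the complex
    statement to the real one. *)
Lemma cvg_complex_bounded (f : 'I_k -> X -> R[i]) (g : X -> R[i]) :
  (forall i b, bmfun (fun x => cpart b (f i x))) -> cintegrable mu g ->
  (fun n => cintegral mu (fun x => (\prod_(i < k) f i (orbit n i x)) * g x)
    : R[i]^o) @ p -->
  ((\prod_(i < k) cintegral mu (f i)) * cintegral mu g : R[i]^o).
Proof.
move=> bf [gr gi].
have gb b : mu.-integrable setT (EFin \o (fun x => cpart b (g x))).
  by case: b.
pose q (s : {ffun 'I_k -> bool}) (b : bool) : R[i] :=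
  (\prod_(i < k) cunit R (s i)) * cunit R b.
pose h n (s : {ffun 'I_k -> bool}) (b : bool) x : R :=
  cpart b (g x) * \prod_(i < k) cpart (s i) (f i (orbit n i x)).
have hi n s b : mu.-integrable setT (EFin \o h n s b).
  have [mu_ [M uM]] : bmfun (fun x => \prod_(i < k) cpart (s i) (f i (orbit n i x))).
    apply: bmfun_prod => i _.
    exact: (bmfun_pow T (P i).[Posz (val n)] (bf i (s i))).
  have bdu : [bounded \prod_(i < k) cpart (s i) (f i (orbit n i x)) | x in setT].
    exists M; split; first exact: num_real.
    by move=> N MN x _ /=; rewrite (le_trans (uM x))// ltW.
  by have := integrableMl measurableT (gb b) mu_ bdu; exact.
have expand (F : 'I_k -> bool -> R) (G : bool -> R) :
    (\prod_(i < k) \sum_(b : bool) cunit R b * (F i b)%:C%C) *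
      (\sum_(b : bool) cunit R b * (G b)%:C%C) =
    \sum_(s : {ffun 'I_k -> bool}) \sum_(b : bool)
      q s b * (G b * \prod_(i < k) F i (s i))%:C%C.
  rewrite bigA_distr_bigA mulr_suml; apply: eq_bigr => s _.
  rewrite mulr_sumr; apply: eq_bigr => b _.
  rewrite big_split /= /q rmorphM rmorph_prod /=; ring.
have lhsE n : cintegral mu (fun x => (\prod_(i < k) f i (orbit n i x)) * g x) =
    \sum_(s : {ffun 'I_k -> bool}) \sum_(b : bool)
      q s b * (\int[mu]_x h n s b x)%:C%C.
  transitivity (cintegral mu (fun x => \sum_(s : {ffun 'I_k -> bool})
      \sum_(b : bool) q s b * (h n s b x)%:C%C)).
    apply: eq_cintegral => x.
    rewrite -(expand (fun i b => cpart b (f i (orbit n i x)))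
      (fun b => cpart b (g x))) -cpartE.
    by congr (_ * _); apply: eq_bigr => i _; exact: cpartE.
  have qh s b : cintegrable mu (fun x => q s b * (h n s b x)%:C%C).
    by apply/cintegrableZ/cintegrable_real; exact: hi.
  have sh s := cintegral_sum (index_enum bool) (qh s).
  have [_ ->] := cintegral_sum (index_enum {ffun 'I_k -> bool})
    (fun s => (sh s).1).
  apply: eq_bigr => s _; rewrite (sh s).2; apply: eq_bigr => b _.
  by rewrite cintegralZ ?cintegral_real//; apply: cintegrable_real; exact: hi.
have cintE (F : X -> R[i]) : cintegral mu F =
    \sum_(b : bool) cunit R b * (\int[mu]_x cpart b (F x))%:C%C.
  by rewrite [LHS]cpartE big_bool [RHS]big_bool.
have -> : (\prod_(i < k) cintegral mu (f i)) * cintegral mu g =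
    \sum_(s : {ffun 'I_k -> bool}) \sum_(b : bool) q s b *
     ((\int[mu]_x cpart b (g x)) *
      \prod_(i < k) \int[mu]_x cpart (s i) (f i x))%:C%C.
  rewrite -(expand (fun i b => \int[mu]_x cpart b (f i x))
    (fun b => \int[mu]_x cpart b (g x))) -cintE.
  by congr (_ * _); apply: eq_bigr => i _.
under [X in X @ p --> _]eq_fun do rewrite lhsE.
apply: cvg_big => [|s _]; first exact: add_continuous.
apply: cvg_big => [|b _]; first exact: add_continuous.
apply: (@cvgZl_tmp _ R[i]^o).
apply/normc_lt_cvg => e e0.
have := cvg_real_integrable (fun i => bf i (s i)) (gb b).
rewrite mulrC => /cvgrPdist_lt/(_ _ e0); apply: filterS => n.
by rewrite /mkset; cbv beta; rewrite distrC -rmorphB /= expr0n addr0 sqrtr_sqr.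
Qed.

End Extension.

Section AlmostEverywhere.
Context (d : measure_display) (X : measurableType d) (R : realType).
Variables (mu : probability X R) (T : invertible_mps mu).

Lemma ae_mps_pow (n : int) (A : set X) :
  (\forall x \ae mu, A x) -> \forall x \ae mu, A (mps_pow T n x).
Proof.
move=> [N [mN N0 AN]]; exists (mps_pow T n @^-1` N); split.
- by rewrite -[_ @^-1` _]setTI; exact: measurable_mps_pow.
- by rewrite -N0; exact: mps_pow_preserving.
- by move=> x /= Ax; apply: AN.
Qed.

Lemma cmeasurable_mps_pow (n : int) (F : X -> R[i]) :
  cmeasurable F -> cmeasurable (fun x => F (mps_pow T n x)).
Proof.
by move=> [Fr Fi]; split; [have := measurableT_comp Fr (measurable_mps_pow T n)
  | have := measurableT_comp Fi (measurable_mps_pow T n)]; exact.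
Qed.

Definition clip (C x : R) : R := Num.max (- `|C|) (Num.min `|C| x).

Lemma clip_bound C x : `|clip C x| <= `|C|.
Proof.
rewrite ler_norml le_max lexx /= ge_max ge_min lexx /= andbT.
by rewrite (le_trans (y := 0))// oppr_le0.
Qed.

Lemma clip_id C x : `|x| <= C -> clip C x = x.
Proof.
move=> xC; have C0 : 0 <= C by exact: le_trans xC.
move: xC; rewrite /clip (ger0_norm C0) ler_norml => /andP[Cx xC].
by rewrite (min_idPr xC); exact/max_idPr.
Qed.

Lemma bmfun_clip C (f : X -> R) :
  measurable_fun setT f -> bmfun (fun x => clip C (f x)).
Proof.
move=> mf; split; last by exists `|C| => x; exact: clip_bound.
apply: measurable_maxr => //.
exact: measurable_minr.
Qed.

(** The bound by the essential supremum becomes an everywhere bound when the real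
    and imaginary parts are truncated. *)
Lemma cLfunoo_clip (F : X -> R[i]) : cLfun mu +oo%E F ->
  exists F', (forall b, bmfun (fun x => cpart b (F' x))) /\
    \forall x \ae mu, F x = F' x.
Proof.
move=> LF; have [mr mi _] := LF; have [C FC] := cLfunoo_bounded LF.
exists (fun x => Complex (clip C (complex.Re (F x))) (clip C (complex.Im (F x)))).
split=> [[]|]; [exact: bmfun_clip|exact: bmfun_clip|].
apply: filterS FC => x FxC; rewrite !clip_id; first by case: (F x).
  exact: le_trans (Im_le_normc _) FxC.
exact: le_trans (Re_le_normc _) FxC.
Qed.

Lemma bmfun_cmeasurable (F : X -> R[i]) :
  (forall b, bmfun (fun x => cpart b (F x))) -> cmeasurable F.
Proof. by move=> bF; split; [case: (bF true)|case: (bF false)]. Qed.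

Hypothesis hT : mildly_mixing T.
Variables (k : nat) (P : 'I_k -> {poly int}).
Hypothesis hP0 : forall i : 'I_k, (1 < size (P i))%N.
Hypothesis hP : forall i j : 'I_k, i != j -> (1 < size (P i - P j)%R)%N.

Lemma cvg_complex (p : set_system posnat) (f : 'I_k -> X -> R[i]) (g : X -> R[i]) :
  idempotent_ultrafilter p ->
  (forall i, cLfun mu +oo%E (f i)) -> cintegrable mu g ->
  (fun n => cintegral mu (fun x =>
     (\prod_(i < k) koopman T (P i).[Posz (val n)] (f i) x) * g x)
    : R[i]^o) @ p -->
  ((\prod_(i < k) cintegral mu (f i)) * cintegral mu g : R[i]^o).
Proof.
move=> hp Lf gi.
have /choice[f' f'P] := fun i => cLfunoo_clip (Lf i).
have bf' i b : bmfun (fun x => cpart b (f' i x)) by have [] := f'P i.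
have ff' i : \forall x \ae mu, f i x = f' i x by have [] := f'P i.
have mf i : cmeasurable (f i) by have [] := Lf i.
have mf' i : cmeasurable (f' i) by exact: bmfun_cmeasurable.
have mg : cmeasurable g.
  by case: gi => /measurable_int/measurable_EFinP ? /measurable_int/measurable_EFinP ?.
have := cvg_complex_bounded hT hP0 hP hp bf' gi.
have -> : \prod_(i < k) cintegral mu (f' i) = \prod_(i < k) cintegral mu (f i).
  by apply: eq_bigr => i _; apply/esym/ae_eq_cintegral.
set u := (X in X @ p --> _); set v := (X in _ -> X @ p --> _).
suff -> : u = v by [].
apply/funext => n; rewrite /u /v; apply: ae_eq_cintegral.
- apply: cmeasurableM => //; apply: cmeasurable_prod => i.
  exact: cmeasurable_mps_pow.
- apply: cmeasurableM => //; apply: cmeasurable_prod => i.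
  exact: cmeasurable_mps_pow.
have : \forall x \ae mu, forall i, f i (mps_pow T (P i).[Posz (val n)] x) =
    f' i (mps_pow T (P i).[Posz (val n)] x).
  apply: filter_forall => i; exact: ae_mps_pow (ff' i).
apply: filterS => x fx; congr (_ * _); apply: eq_bigr => i _.
by rewrite /koopman fx.
Qed.

End AlmostEverywhere.

Theorem corollary7p6 (d : measure_display) (X : measurableType d) (R : realType)
    (mu : probability X R) (T : invertible_mps mu) (hT : mildly_mixing T)
    (k : nat) (P : 'I_k -> {poly int})
    (hP0 : forall i : 'I_k, (1 < size (P i))%N)
    (hP : forall i j : 'I_k, i != j -> (1 < size (P i - P j)%R)%N) :
  (forall p : set_system posnat, idempotent_ultrafilter p ->
   forall f : 'I_k -> X -> R[i], (forall i, cLfun mu +oo%E (f i)) ->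
     weak_plim mu p
       (fun n x => \prod_(i < k) koopman T (P i).[Posz (val n)] (f i) x)
       (fun _ => \prod_(i < k) cintegral mu (f i))) /\
  (forall f : 'I_k -> X -> R[i], (forall i, cLfun mu +oo%E (f i)) ->
   forall e : R, 0 < e ->
   forall f0 : X -> R[i], cLfun mu 2%:E f0 ->
     IP_star [set n : posnat |
       ComplexField.Normc.normc
         (cintegral mu (fun x => f0 x *
            \prod_(i < k) koopman T (P i).[Posz (val n)] (f i) x)
          - cintegral mu f0 * \prod_(i < k) cintegral mu (f i)) < e]).
Proof.
split=> [p hp f Lf|f Lf e e0 f0 f02 s _].
  have FF : ProperFilter p := @ultra_proper _ _ hp.1.
  apply/weak_plimP => g g2.
  have [gr gi] := cLfun2_cintegrable g2.
  have cgi : cintegrable mu (fun x => conjc (g x)).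
    split; first by apply: eq_integrable gr => // x _ /=; case: (g x).
    have := integrableN gi; apply: eq_integrable => // x _ /=.
    by case: (g x) => a b /=; rewrite EFinN.
  have := cvg_complex hT hP0 hP hp Lf cgi => /normc_lt_cvg.
  by rewrite -(cintegralZ _ cgi); exact.
have [p [hp ps]] := IP_set_idempotent s.
have FF : ProperFilter p := @ultra_proper _ _ hp.1.
have /normc_lt_cvg/(_ _ e0) := cvg_complex hT hP0 hP hp Lf (cLfun2_cintegrable f02).
move=> /(filterI ps)/filter_ex[n [ns nE]]; exists n; split=> //=.
move: nE; rewrite mulrC /=; congr (ComplexField.Normc.normc (_ - _) < e).
by apply: eq_cintegral => x; rewrite mulrC.
Qed.
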